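(* Let $0<\alpha<\frac12$ be fixed, and let $Z_\alpha$ be the minimum cost of a path from vertex $1$ to vertex $2$ in the randomly weighted, randomly coloured complete graph (or complete digraph) on vertex set $\{1,\dots,n\}$, among paths containing at most $\alpha\log n$ red edges. Then w.h.p. $$Z_\alpha\sim\frac{\lambda\log n}{n},$$ where $\lambda=\lambda(\alpha)>0$ is the unique solution to $$\frac{\lambda}{2}+\alpha\log\left(\frac{\lambda}{2\alpha}\right)+\alpha-1=0 .$$
   Context: Model: each edge $e$ of the complete graph $K_n$ (respectively each directed edge of the complete digraph $\vec K_n$) is given an independent cost $X_e$ with the exponential distribution of mean 1, i.e. $\Pr(X_e\ge x)=e^{-x}$ for $x\ge0$. Edges are then independently coloured red or blue with probability $1/2$ each. The cost of a path is the sum of the costs of its edges (in the digraph case paths are directed). It is assumed that $\alpha\log n$ is an integer. Asymptotics are as $n\to\infty$ with $\alpha$ fixed. Events occur with high probability (w.h.p.) if their probability tends to $1$; ''$Z_\alpha\sim b_n$ w.h.p.'' means that for every $\varepsilon>0$, $|Z_\alpha-b_n|\le\varepsilon b_n$ w.h.p. *)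

(* Defs.v *)
From HB Require Import structures.
From mathcomp Require Export all_boot all_order all_algebra.
From mathcomp Require Export all_classical all_reals all_analysis.
Export Order.TTheory GRing.Theory Num.Theory.
Export numFieldNormedType.Exports.

Set Implicit Arguments.
Unset Strict Implicit.
Unset Printing Implicit Defensive.

Local Open Scope classical_set_scope.
Local Open Scope ring_scope.

(* Mutual independence of the set systems F i, for i in D: the product rule
   over every subfamily J of D. *)
Definition mutually_independent (R : realType) (d : measure_display)
    (T : measurableType d) (P : probability T R)
    (I : finType) (D : {set I}) (F : I -> set (set T)) : Prop :=
  forall (J : {set I}) (A : I -> set T), J \subset D ->
    (forall i, i \in J -> F i (A i)) ->
    (P (\bigcap_(i in [set` J]) A i) = \prod_(i in J) P (A i))%E.

Definition generated_events (d d' : measure_display) (T : measurableType d)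
    (T' : measurableType d') (X : T -> T') : set (set T) :=
  preimage_set_system setT X measurable.

(* E is a type of edge labels and D the set of those labels that are edges of
   the (di)graph; nothing is assumed about the values of X and red off D.
   The colour of e is red when [red e] is true and blue otherwise. *)
Record coloured_costs (R : realType) (d : measure_display)
    (T : measurableType d) (P : probability T R) (E : finType) (D : {set E})
    (X : E -> {RV P >-> R}) (red : E -> {RV P >-> bool}) : Prop := {
  cost_law : forall e, e \in D -> forall A : set R, measurable A ->
    P (X e @^-1` A) = exponential_prob 1 A ;
  colour_law : forall e, e \in D -> P [set w | red e w] = (2^-1)%:E ;
  costs_colours_independent :
    mutually_independent P
      [set s : E + E | match s with inl e => e \in D | inr e => e \in D end]
      (fun s : E + E => match s with
                        | inl e => generated_events (X e)
                        | inr e => generated_events (red e)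
                        end)
}.

Definition complete_graph (V : finType) : {set {set V}} :=
  [set e : {set V} | #|e| == 2%N].

Definition complete_digraph (V : finType) : {set V * V} :=
  [set e : V * V | e.1 != e.2].

Definition undirected_edge (V : finType) (i j : V) : {set V} := [set i; j]%SET.

Definition directed_edge (V : finType) (i j : V) : V * V := (i, j).

(* The vertices of the path are those of x :: p, and [pairmap edge x p] lists
   its successive edges. *)
Definition path_between (V : finType) (x y : V) (p : seq V) : Prop :=
  uniq (x :: p) /\ last x p = y.

(* The infimum is over a finite set, hence a minimum, unless no path has at
   most r red edges, in which case the value is +oo. *)
Definition min_cost (R : realType) (V E : finType) (edge : V -> V -> E)
    (X : E -> R) (red : E -> bool) (r : R) (x y : V) : \bar R :=
  ereal_inf [set (\sum_(e <- pairmap edge x p) X e)%:E |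
    p in [set p : seq V | path_between x y p /\
                          (count red (pairmap edge x p))%:R <= r]].

Definition whp (R : realType) (d : nat -> measure_display)
    (T : forall n, measurableType (d n)) (P : forall n, probability (T n) R)
    (A : forall n, set (T n)) : Prop :=
  P n (A n) @[n --> \oo] --> 1%E.

Definition whp_equivalent (R : realType) (d : nat -> measure_display)
    (T : forall n, measurableType (d n)) (P : forall n, probability (T n) R)
    (Z : forall n, T n -> \bar R) (b : nat -> R) : Prop :=
  forall eps : R, 0 < eps ->
    whp P (fun n => [set w | (`|Z n w - (b n)%:E| <= (eps * b n)%:E)%E]).

Definition rate_equation (R : realType) (alpha lambda : R) : Prop :=
  lambda / 2 + alpha * ln (lambda / (2 * alpha)) + alpha - 1 = 0.

(* Vertices 1 and 2 of the vertex set {1, ..., n + 2}, encoded as 'I_n.+2. *)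
Definition vertex1 (n : nat) : 'I_n.+2 := ord0.
Definition vertex2 (n : nat) : 'I_n.+2 := inord 1.

(* Main.v *)
Require Import Defs.
From mathcomp Require Import measurable_realfun ring lra zify.

Set Implicit Arguments.
Unset Strict Implicit.
Unset Printing Implicit Defensive.

(** Write [N] for the number of vertices and [lambda] for the root of the rate
equation.  Both the graph and the digraph are treated at once, through a map
[edge : V -> V -> E] that can only identify an edge with its reversal
([edge_injective]).

Costs are cut into classes of width [eta / N].  The label of an edge, its class
and its colour, ranges over a finite type, so that every event about labels is
computed in a finite product measure ([labels_law]), where independence and
adaptive choices are identities between finite sums ([Ex_prod],
[Ex_resample]).

Lower bound.  A path of [l] edges is cheap, that is, has cost at most
[Lam / N] and at most [rho] red edges, with probability at most
[exp (theta * Lam + sigma * rho)] times a product of [l] factors, one for each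
edge, each of them at most [tilted_mass / N].  There are at most [N ^ (l - 1)]
paths of [l] edges.  With [exp (- sigma) = 2 * alpha / lambda] and [theta]
slightly above [(1 + exp (- sigma)) / 2], the [tilted_mass] is below 1, the
geometric series over [l] converges, and the union bound is a constant times
[exp (theta * Lam + sigma * rho) / N].  The rate equation says that the
exponent is exactly [ln N] when [theta = (1 + exp (- sigma)) / 2],
[Lam = lambda * ln N] and [rho = alpha * ln N]; hence the bound tends to 0 as
soon as [Lam] is smaller by a constant factor ([lower_asymptotic]).

Upper bound.  From vertex 1, and backwards from vertex 2, sets of about
[sqrt N] reached vertices are grown, and the two sets are joined by one last
edge.  The growth is made of blocks of [h = t + r] generations.  In one
generation all edges between the active vertices and the fresh ones are
revealed, and for every short label a prescribed number of fresh vertices,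
reached through an edge with that label, become active; by Chebyshev's
inequality this fails with a probability inversely proportional to the number
of active vertices ([certified_step]).  The active vertices of a block are
sorted by the sequence of labels that led to them.  After [h] generations only
the sequences of small total class with at most [r] red labels are kept.  By
counting these sequences ([light_types_ge]) the number of reached vertices is
multiplied by [m0] in each block.  By Stirling's formula and
the rate equation, the parameters can be chosen so that a block costs at most
about [lambda * ln m0 / N] and uses fewer than [alpha * ln m0] red edges
([block_choice]).  Reaching [sqrt N] vertices from both ends takes
[ln N / ln m0] blocks in total, which gives the announced cost and number of
red edges.  Since the number of active vertices grows geometrically, the
failure probabilities add up to a multiple of that of the first block, which is
small because the growth starts from a large constant number of neighbours,
reached by a single edge whose cost is a small multiple of [ln N / N]
([certified_connection]). *)

(** * Finite product measures *)

Section ProductMeasure.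
Local Open Scope set_scope.
Local Open Scope ring_scope.
Import fintype boot.finset.
Variables (R : realFieldType) (E L : finType) (w : E -> L -> R).
Hypothesis w_ge0 : forall e l, 0 <= w e l.
Hypothesis w_sum1 : forall e, \sum_l w e l = 1.

Definition mass (f : {ffun E -> L}) : R := \prod_e w e (f e).

Definition Ex (phi : {ffun E -> L} -> R) : R := \sum_f mass f * phi f.

Definition Pr (A : {set {ffun E -> L}}) : R := \sum_(f in A) mass f.

Lemma mass_ge0 f : 0 <= mass f.
Proof. by apply: prodr_ge0 => e _. Qed.

Lemma ExD phi psi : Ex (fun f => phi f + psi f) = Ex phi + Ex psi.
Proof. by rewrite /Ex -big_split; apply: eq_bigr => f _; rewrite mulrDr. Qed.

Lemma ExZ (c : R) phi : Ex (fun f => c * phi f) = c * Ex phi.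
Proof. by rewrite /Ex mulr_sumr; apply: eq_bigr => f _; rewrite mulrCA. Qed.

Lemma Ex_sum (I : finType) (P : pred I) (phi : I -> {ffun E -> L} -> R) :
  Ex (fun f => \sum_(i | P i) phi i f) = \sum_(i | P i) Ex (phi i).
Proof.
rewrite /Ex exchange_big; apply: eq_bigr => f _ /=.
by rewrite mulr_sumr.
Qed.

Lemma Ex_le phi psi : (forall f, phi f <= psi f) -> Ex phi <= Ex psi.
Proof. by move=> le; apply: ler_sum => f _; rewrite ler_wpM2l ?mass_ge0. Qed.

Lemma eq_Ex phi psi : phi =1 psi -> Ex phi = Ex psi.
Proof. by move=> e; apply: eq_bigr => f _; rewrite e. Qed.

Lemma Ex_prod (phi : E -> L -> R) :
  Ex (fun f => \prod_e phi e (f e)) = \prod_e \sum_l w e l * phi e l.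
Proof.
rewrite bigA_distr_bigA /=; apply: eq_bigr => f _.
by rewrite /mass -big_split.
Qed.

Lemma Ex1 : Ex (fun=> 1) = 1.
Proof.
have := Ex_prod (fun _ _ => 1).
under eq_Ex => f do rewrite big1 //.
move=> ->; rewrite big1// => e _; under eq_bigr do rewrite mulr1; exact: w_sum1.
Qed.

Lemma PrE A : Pr A = Ex (fun f => (f \in A)%:R).
Proof.
rewrite /Pr big_mkcond; apply: eq_bigr => f _.
by case: (f \in A); rewrite ?mulr1 ?mulr0.
Qed.

Lemma PrT : Pr [set: {ffun E -> L}] = 1.
Proof. by rewrite -[RHS]Ex1 PrE; apply: eq_Ex => f; rewrite inE. Qed.

Lemma Pr_ge0 A : 0 <= Pr A.
Proof. by apply: sumr_ge0 => f _; exact: mass_ge0. Qed.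

Lemma Pr_subset (A B : {set {ffun E -> L}}) : A \subset B -> Pr A <= Pr B.
Proof.
move=> sAB; rewrite !PrE; apply: Ex_le => f; rewrite ler_nat.
by case: (boolP (f \in A)) => // /(subsetP sAB) ->.
Qed.

Lemma PrC A : Pr (~: A) = 1 - Pr A.
Proof.
apply/eqP; rewrite eq_sym subr_eq -PrT !PrE -ExD; apply/eqP/eq_Ex => f.
by rewrite !inE; case: (f \in A); rewrite ?addr0 ?add0r.
Qed.

Lemma Pr_bigcup_le (I : finType) (P : pred I) (A : I -> {set {ffun E -> L}}) :
  Pr (\bigcup_(i | P i) A i) <= \sum_(i | P i) Pr (A i).
Proof.
under [leRHS]eq_bigr do rewrite PrE.
rewrite -Ex_sum PrE; apply: Ex_le => f.
case: bigcupP => [[i Pi fi]|_]; last by apply: sumr_ge0 => *; rewrite ler0n.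
by rewrite (bigD1 i)//= fi lerDl; apply: sumr_ge0 => *; rewrite ler0n.
Qed.

Lemma Pr_bigcup_disjoint (I : finType) (P : pred I)
    (A : I -> {set {ffun E -> L}}) :
    (forall i j f, P i -> P j -> f \in A i -> f \in A j -> i = j) ->
  Pr (\bigcup_(i | P i) A i) = \sum_(i | P i) Pr (A i).
Proof.
move=> dis; under [RHS]eq_bigr do rewrite PrE.
rewrite -Ex_sum PrE; apply: eq_Ex => f.
case: bigcupP => [[i Pi fi]|nA].
  rewrite (bigD1 i)//= fi big1 ?addr0// => j /andP[Pj ji].
  case: (boolP (f \in A j)) => // fj.
  by rewrite (dis _ _ _ Pj Pi fj fi) eqxx in ji.
rewrite big1// => i Pi; case: (boolP (f \in A i)) => // fi.
by case: nA; exists i.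
Qed.

Lemma Pr_coord e (S : {set L}) :
  Pr [set f : {ffun E -> L} | f e \in S] = \sum_(l in S) w e l.
Proof.
rewrite PrE (eq_Ex (psi := fun f => \prod_e'
   (if e' == e then ((f e' \in S)%:R : R) else 1))); last first.
  by move=> f; rewrite inE -big_mkcond big_pred1_eq.
rewrite (Ex_prod (fun e' l => if e' == e then ((l \in S)%:R : R) else 1)).
rewrite (bigD1 e)//= [X in _ * X]big1 ?mulr1; last first.
  move=> e' /negbTE ne; rewrite ne; under eq_bigr do rewrite mulr1; exact: w_sum1.
rewrite [RHS]big_mkcond eqxx; apply: eq_bigr => l _.
by case: (l \in S); rewrite ?mulr1 ?mulr0.
Qed.

Definition merge (D : {set E}) (g f : {ffun E -> L}) : {ffun E -> L} :=
  [ffun e => if e \in D then g e else f e].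

(** Two independent samples may exchange their coordinates in [D]: the exchange
is an involution that preserves the product of the masses.  Replacing the
coordinates outside [D] by fresh ones thus changes no mean. *)
Lemma Ex_resample (D : {set E}) phi :
  Ex phi = Ex (fun g => Ex (fun f => phi (merge D g f))).
Proof.
transitivity (\sum_(p : {ffun E -> L} * {ffun E -> L})
    mass p.1 * (mass p.2 * phi p.1)).
  rewrite -(pair_bigA _ (fun g f => mass g * (mass f * phi g))) /=.
  apply: eq_bigr => g _; rewrite -mulr_sumr -mulr_suml; congr (_ * _).
  by rewrite -[LHS]mul1r -Ex1; congr (_ * _); apply: eq_bigr => f _; rewrite mulr1.
pose sw (p : {ffun E -> L} * {ffun E -> L}) := (merge D p.1 p.2, merge D p.2 p.1).
have swK : involutive sw.
  case=> g f; rewrite /sw /=; congr pair; apply/ffunP => e; rewrite !ffunE;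
  by case: (e \in D).
rewrite (reindex_inj (inv_inj swK)) /=.
rewrite /Ex; under [RHS]eq_bigr do rewrite mulr_sumr.
rewrite pair_bigA /=; apply: eq_bigr => -[g f] _ /=.
rewrite !mulrA; congr (_ * _); rewrite /mass -!big_split /=.
apply: eq_bigr => e _; rewrite !ffunE; case: (e \in D) => //; exact: mulrC.
Qed.

Definition depends_on (D : {set E}) (A : {set {ffun E -> L}}) : Prop :=
  forall f g : {ffun E -> L}, {in D, f =1 g} -> (f \in A) = (g \in A).

Lemma depends_onS (D D' : {set E}) A :
  D \subset D' -> depends_on D A -> depends_on D' A.
Proof.
move=> /subsetP sD dA f g fg; apply: dA => e eD; apply: fg; exact: sD.
Qed.

Lemma merge_in (D : {set E}) g f : {in D, merge D g f =1 g}.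
Proof. by move=> e eD; rewrite ffunE eD. Qed.

Lemma merge_notin (D : {set E}) g f : {in ~: D, merge D g f =1 f}.
Proof. by move=> e; rewrite !inE ffunE => /negbTE ->. Qed.

(** The event [H f] may be chosen in view of the coordinates of [f] in [D]:
after resampling, the other coordinates are fresh. *)
Lemma Pr_adaptive (D : {set E}) (G : {set {ffun E -> L}})
    (H : {ffun E -> L} -> {set {ffun E -> L}}) (b : R) :
    depends_on D G ->
    (forall f g : {ffun E -> L}, {in D, f =1 g} -> H f = H g) ->
    (forall g, g \in G -> depends_on (~: D) (H g)) ->
    (forall g, g \in G -> b <= Pr (H g)) ->
  b * Pr G <= Pr [set f in G | f \in H f].
Proof.
move=> dG eqH dH bH.
rewrite [leRHS]PrE (Ex_resample D) PrE -ExZ; apply: Ex_le => g.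
have [gG|gG] := boolP (g \in G).
  rewrite mulr1; apply: le_trans (bH _ gG) _; rewrite PrE; apply: Ex_le => f.
  rewrite inE (dG _ _ (@merge_in D g f)) gG (eqH _ _ (@merge_in D g f)) /=.
  by rewrite (dH _ gG _ _ (@merge_notin D g f)).
rewrite mulr0; apply: sumr_ge0 => f _.
by rewrite mulr_ge0 ?mass_ge0 ?ler0n.
Qed.

Lemma Pr_indep (D : {set E}) (G H : {set {ffun E -> L}}) :
  depends_on D G -> depends_on (~: D) H -> Pr (G :&: H) = Pr G * Pr H.
Proof.
move=> dG dH; rewrite PrE (Ex_resample D) [in RHS]mulrC [Pr G]PrE -ExZ.
apply: eq_Ex => g; rewrite mulrC PrE -ExZ; apply: eq_Ex => f.
rewrite inE (dG _ _ (@merge_in D g f)) (dH _ _ (@merge_notin D g f)).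
by case: (g \in G); case: (f \in H); rewrite ?mulr1 ?mulr0.
Qed.

Lemma Pr_indepS (D D' : {set E}) (G H : {set {ffun E -> L}}) :
    [disjoint D & D'] -> depends_on D G -> depends_on D' H ->
  Pr (G :&: H) = Pr G * Pr H.
Proof.
move=> dis dG dH; apply: (@Pr_indep D) => //; apply: depends_onS dH.
by rewrite -disjoints_subset disjoint_sym.
Qed.

(** Chebyshev's inequality for a sum of pairwise independent indicators: its
variance is at most its mean. *)
Lemma Pr_few_le (U : finType) (F : {set U}) (Z : U -> {set {ffun E -> L}})
    (s : nat) (delta : R) :
    0 < delta -> (0 < s)%N ->
    {in F &, forall u v, u != v -> Pr (Z u :&: Z v) = Pr (Z u) * Pr (Z v)} ->
    (1 + delta) * s%:R <= \sum_(u in F) Pr (Z u) ->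
  Pr [set f | #|[set u in F | f \in Z u]| < s]%N
    <= (1 + delta) / (delta ^+ 2 * s%:R).
Proof.
move=> d0 s0 indep; set m := \sum_(u in F) _ => sm.
pose Y (f : {ffun E -> L}) : R := \sum_(u in F) (f \in Z u)%:R.
have cardY f : #|[set u in F | f \in Z u]|%:R = Y f.
  rewrite /Y -sum1dep_card natr_sum big_mkcondr /=.
  by apply: eq_bigr => u _; case: (f \in Z u).
have EY : Ex Y = m by rewrite /Y Ex_sum; apply: eq_bigr => u _; rewrite -PrE.
have EY2 : Ex (fun f => Y f ^+ 2) <= m + m ^+ 2.
  have -> : Ex (fun f => Y f ^+ 2)
      = \sum_(u in F) \sum_(v in F) Pr (Z u :&: Z v).
    under eq_Ex => f do rewrite expr2 {1}/Y mulr_suml.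
    rewrite Ex_sum; apply: eq_bigr => u _.
    under eq_Ex => f do rewrite /Y mulr_sumr.
    rewrite Ex_sum; apply: eq_bigr => v _; rewrite PrE; apply: eq_Ex => f.
    by rewrite inE; case: (f \in Z u); rewrite ?mul1r ?mul0r.
  rewrite expr2 {3}/m mulr_suml -big_split /=; apply: ler_sum => u uF.
  rewrite (bigD1 u)//= setIid lerD2l mulr_sumr.
  rewrite [leRHS](bigD1 u)//= -[leLHS]add0r lerD ?mulr_ge0 ?Pr_ge0//.
  by apply: ler_sum => v /andP[vF vu]; rewrite indep// eq_sym.
have sR0 : 0 < s%:R :> R by rewrite ltr0n.
have m0 : 0 < m by apply: lt_le_trans sm; rewrite mulr_gt0// addr_gt0.
have ms : delta * m <= (1 + delta) * (m - s%:R) by lra.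
have ms0 : 0 < m - s%:R.
  rewrite -(@pmulr_rgt0 _ (1 + delta)) ?addr_gt0//.
  by apply: lt_le_trans ms; rewrite mulr_gt0.
set A := [set f | _].
have step1 : (m - s%:R) ^+ 2 * Pr A <= m.
  apply: le_trans (_ : Ex (fun f => Y f ^+ 2 + ((- (2 * m)) * Y f + m ^+ 2 * 1)) <= _).
    rewrite PrE -ExZ; apply: Ex_le => f; rewrite inE.
    rewrite (_ : _ + _ = (m - Y f) ^+ 2); last by ring.
    case: ltnP => [lt|_]; last by rewrite mulr0 sqr_ge0.
    rewrite mulr1 ler_sqr ?nnegrE ?(ltW ms0)//.
      by rewrite lerD2l lerN2 -cardY ler_nat ltnW.
    apply: le_trans (ltW ms0) _.
    by rewrite lerD2l lerN2 -cardY ler_nat ltnW.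
  rewrite !ExD !ExZ EY Ex1; move: EY2; lra.
have step2 : Pr A <= m / (m - s%:R) ^+ 2.
  by rewrite ler_pdivlMr ?exprn_gt0// mulrC.
apply: le_trans step2 _.
rewrite ler_pdivrMr ?exprn_gt0// mulrAC ler_pdivlMr; last first.
  by rewrite mulr_gt0 ?exprn_gt0.
have h1 : (delta * m) ^+ 2 <= ((1 + delta) * (m - s%:R)) ^+ 2.
  by rewrite ler_sqr ?nnegrE// ?mulr_ge0 ?(ltW d0) ?(ltW m0) ?(ltW ms0)// addr_ge0// ltW.
have h2 : (1 + delta) * s%:R * (m * delta ^+ 2) <= m * (m * delta ^+ 2).
  by rewrite ler_wpM2r// mulr_ge0 ?(ltW m0)// exprn_ge0// ltW.
rewrite -(@ler_pM2l _ (1 + delta)) ?addr_gt0//.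
apply: le_trans (_ : (delta * m) ^+ 2 <= _).
  by move: h2; rewrite !expr2; lra.
apply: le_trans h1 _; rewrite le_eqVlt; apply/orP; left; apply/eqP; ring.
Qed.

End ProductMeasure.

(** * Revealing the edges from a set of vertices *)

(** Distinct unordered pairs of vertices have distinct edges: this holds for graphs
and for digraphs, and also after all edges have been reversed. *)
Definition edge_injective (V E : Type) (edge : V -> V -> E) : Prop :=
  forall i j i' j', edge i j = edge i' j' ->
  (i = i' /\ j = j') \/ (i = j' /\ j = i').

Section Exploration.
Local Open Scope set_scope.
Local Open Scope ring_scope.
Import fintype boot.finset.
Variables (R : realFieldType) (V E L : finType).
Variables (w : E -> L -> R) (edge : V -> V -> E).
Hypothesis w_ge0 : forall e l, 0 <= w e l.
Hypothesis w_sum1 : forall e, \sum_l w e l = 1.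
Hypothesis edge_inj : edge_injective edge.

Definition between (A B : {set V}) : {set E} := [set edge i j | i in A, j in B].

(** Since the event depends only on the edges inside [W], it keeps its
probability [b] after an exploration has revealed edges outside [W].  The
consequence [C] is an arbitrary statement about all labels, so that facts about
the edges already revealed can enter it as hypotheses; this lets one reason
backwards, from the last exploration to the first. *)
Definition certified (W : {set V}) (b : R) (C : {ffun E -> L} -> Prop) : Prop :=
  exists Ev : {set {ffun E -> L}},
    [/\ depends_on (between W W) Ev, b <= Pr w Ev & forall f, f \in Ev -> C f].

Lemma betweenS (A A' B B' : {set V}) :
  A \subset A' -> B \subset B' -> between A B \subset between A' B'.
Proof.
move=> /subsetP sA /subsetP sB; apply/subsetP => _ /imset2P[i j iA jB ->].
by apply: imset2_f; [apply: sA|apply: sB].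
Qed.

Lemma certified_mono (W W' : {set V}) (b b' : R) (C C' : {ffun E -> L} -> Prop) :
    W \subset W' -> b' <= b -> (forall f, C f -> C' f) ->
  certified W b C -> certified W' b' C'.
Proof.
move=> sW bb CC [Ev [dE PE EC]]; exists Ev; split.
- by apply: depends_onS dE; exact: betweenS.
- exact: le_trans PE.
- by move=> f /EC /CC.
Qed.

Lemma certified_true (W : {set V}) (C : {ffun E -> L} -> Prop) :
  (forall f, C f) -> certified W 1 C.
Proof.
move=> CT; exists [set: {ffun E -> L}]; split=> //.
- by move=> f g _; rewrite !inE.
- by rewrite PrT.
Qed.

Lemma certified_le0 (W : {set V}) (b : R) (C : {ffun E -> L} -> Prop) :
  b <= 0 -> certified W b C.
Proof.
move=> b0; exists set0; split=> [f g _|| f]; rewrite ?inE//.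
by rewrite /Pr big_set0.
Qed.

Lemma between_disjoint (A A' B B' : {set V}) :
    [disjoint A & A'] -> [disjoint A & B'] ->
  [disjoint between A B & between A' B'].
Proof.
move=> d1 d2; rewrite -setI_eq0; apply/eqP/setP => e; rewrite !inE.
apply/andP => -[/imset2P[i j iA jB ->] /imset2P[i' j' iA' jB' /edge_inj]].
by case=> -[? ?]; subst; [rewrite (disjointFr d1 iA) in iA'|
                         rewrite (disjointFr d2 iA) in jB'].
Qed.

Section Step.
Variables (Om I : finType) (lab : L -> option Om) (q Q delta : R).
Variables (A : I -> {set V}) (Fr : {set V}) (s : nat).

Let UA := \bigcup_i A i.

Hypothesis q_ge0 : 0 <= q.
Hypothesis q_le : forall i j a, i != j ->
  q <= \sum_(l | lab l == Some a) w (edge i j) l.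
Hypothesis Q_ge : forall i j, i != j ->
  \sum_(l | lab l != None) w (edge i j) l <= Q.
Hypothesis disA : forall i j, i != j -> [disjoint A i & A j].
Hypothesis disF : forall i, [disjoint A i & Fr].
Hypothesis delta_gt0 : 0 < delta.
Hypothesis s_gt0 : (0 < s)%N.
Hypothesis s_le : forall i,
  (1 + delta) * s%:R <= #|A i|%:R * q * #|Fr|%:R * (1 - #|UA|%:R * Q).

Definition linked (f : {ffun E -> L}) (B : I * Om -> {set V}) : Prop :=
  forall i a u, u \in B (i, a) ->
  exists2 v, v \in A i & lab (f (edge v u)) = Some a.

Definition offspring (B : I * Om -> {set V}) : Prop :=
  [/\ forall p, B p \subset Fr, forall p, #|B p| = s
    & forall p p', p != p' -> [disjoint B p & B p']].

(** Demanding that [v] be the only vertex of [UA] with a useful edge to [u] makes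
the events for distinct types disjoint, at the price of the factor
[1 - #|UA| * Q]; for distinct [u] they depend on disjoint sets of edges. *)
Let hit (v u : V) (a : Om) : {set {ffun E -> L}} :=
  [set f : {ffun E -> L} | f (edge v u) \in [set l | lab l == Some a]] :&:
  [set f : {ffun E -> L} |
    [forall v' in UA, (v' != v) ==> (lab (f (edge v' u)) == None)]].

Let Z (p : I * Om) (u : V) : {set {ffun E -> L}} :=
  \bigcup_(v in A p.1) hit v u p.2.

Let cand (p : I * Om) (f : {ffun E -> L}) : {set V} :=
  [set u in Fr | f \in Z p u].

Let disUF : [disjoint UA & Fr].
Proof.
rewrite -setI_eq0; apply/eqP/setP => v; rewrite !inE.
apply/andP => -[/bigcupP[i _ vi] vF].
by rewrite (disjointFr (disF i) vi) in vF.
Qed.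

Let AUA i v : v \in A i -> v \in UA.
Proof. by move=> vi; apply/bigcupP; exists i. Qed.

Let neqAF u v : u \in UA -> v \in Fr -> u != v.
Proof.
by move=> uA vF; apply: contraTneq uA => ->; rewrite (disjointFl disUF vF).
Qed.

Let edgeAF v v' u u' : v \in UA -> v' \in UA -> u \in Fr -> u' \in Fr ->
  edge v u = edge v' u' -> v = v' /\ u = u'.
Proof.
move=> vA v'A uF u'F /edge_inj[//|[e _]].
by have := neqAF vA u'F; rewrite e eqxx.
Qed.

Let hit_dep v u a : v \in UA -> depends_on (between UA [set u]) (hit v u a).
Proof.
move=> vA f g fg; rewrite !inE.
have fgE v' : v' \in UA -> f (edge v' u) = g (edge v' u).
  by move=> v'A; apply: fg; apply: imset2_f; rewrite ?inE.
rewrite fgE//; congr (_ && _); apply: eq_forallb => v'.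
by case: (boolP (v' \in UA)) => //= /fgE ->.
Qed.

Let Z_dep p u : depends_on (between UA [set u]) (Z p u).
Proof.
move=> f g fg; apply/bigcupP/bigcupP => -[v vA fv]; exists v => //;
by move: fv; rewrite (hit_dep p.2 (AUA vA) fg).
Qed.

Let hit_Pr v u a : v \in UA -> u \in Fr -> q * (1 - #|UA|%:R * Q) <= Pr w (hit v u a).
Proof.
move=> vA uF; rewrite (Pr_indepS w_sum1 (D := [set edge v u])
   (D' := between (UA :\ v) [set u])); last 3 first.
- rewrite disjoints1; apply/imset2P => -[v' u' /setD1P[v'v v'A] /set1P -> /edgeAF].
  by case/(_ vA v'A uF uF) => e; rewrite e eqxx in v'v.
- by move=> f g fg; rewrite !inE fg// inE.
- move=> f g fg; rewrite !inE; apply: eq_forallb => v'.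
  case: (boolP (v' \in UA)) => //= v'A; case: (boolP (v' == v)) => //= v'v.
  by rewrite fg// imset2_f// !inE ?v'v.
rewrite (Pr_coord w_sum1).
apply: le_trans (_ : q * Pr w [set f : {ffun E -> L} |
    [forall v' in UA, (v' != v) ==> (lab (f (edge v' u)) == None)]] <= _); last first.
  rewrite ler_wpM2r ?Pr_ge0//; under eq_bigl do rewrite inE.
  by apply: q_le; exact: neqAF.
rewrite ler_wpM2l//.
set N := [set f | _].
rewrite lerBlDr -lerBlDl -(PrC w_sum1).
apply: le_trans (_ : Pr w (\bigcup_(v' in UA)
   [set f : {ffun E -> L} | f (edge v' u) \in [set l | lab l != None]]) <= _).
  apply: Pr_subset => //; apply/subsetP => f; rewrite !inE.
  rewrite negb_forall_in => /exists_inP[v' v'A].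
  rewrite negb_imply => /andP[_ ne]; apply/bigcupP; exists v' => //.
  by rewrite !inE.
apply: le_trans (Pr_bigcup_le w_ge0 _ _) _.
rewrite -sum1_card natr_sum mulr_suml; apply: ler_sum => v' v'A.
rewrite (Pr_coord w_sum1) mul1r; under eq_bigl do rewrite inE.
by apply: Q_ge; exact: neqAF.
Qed.

Let Z_Pr p u : u \in Fr ->
  #|A p.1|%:R * q * (1 - #|UA|%:R * Q) <= Pr w (Z p u).
Proof.
move=> uF; rewrite Pr_bigcup_disjoint//; last first.
  move=> v v' f vA v'A; rewrite !inE => /andP[/eqP fv _] /andP[_].
  move=> /forall_inP/(_ _ (AUA vA)); rewrite fv.
  by case: eqVneq.
rewrite -sum1_card natr_sum !mulr_suml; apply: ler_sum => v vA.
by rewrite mul1r; apply: hit_Pr => //; exact: AUA vA.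
Qed.

Let cand_Pr p : Pr w [set f | #|cand p f| < s]%N
  <= (1 + delta) / (delta ^+ 2 * s%:R).
Proof.
apply: Pr_few_le => //.
  move=> u v uF vF uv; apply: (Pr_indepS w_sum1 _ (@Z_dep p u) (@Z_dep p v)).
  rewrite -setI_eq0; apply/eqP/setP => e; rewrite !inE.
  apply/andP => -[/imset2P[i j iA /set1P -> ->]].
  move=> /imset2P[i' j' iA' /set1P -> /edgeAF].
  by case/(_ iA iA' uF vF) => _ e'; rewrite e' eqxx in uv.
apply: le_trans (s_le p.1) _.
rewrite mulrAC mulr_natr -sumr_const.
by apply: ler_sum => u uF; exact: Z_Pr.
Qed.

Let many : {set {ffun E -> L}} := [set f | [forall p, s <= #|cand p f|]%N].

Let many_Pr : 1 - #|{: I * Om}|%:R * ((1 + delta) / (delta ^+ 2 * s%:R)) <= Pr w many.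
Proof.
rewrite lerBlDr -lerBlDl -(PrC w_sum1).
apply: le_trans (_ : Pr w (\bigcup_p [set f | #|cand p f| < s]%N) <= _).
  apply: Pr_subset => //; apply/subsetP => f; rewrite !inE negb_forall.
  by move=> /existsP[p]; rewrite -ltnNge => lt; apply/bigcupP; exists p; rewrite ?inE.
apply: le_trans (Pr_bigcup_le w_ge0 _ _) _.
rewrite mulr_natl -sumr_const.
by apply: ler_sum => p _; exact: cand_Pr.
Qed.

Let trim (S : {set V}) : {set V} := [set x in take s (enum S)].

Let trim_sub (S : {set V}) : trim S \subset S.
Proof.
by apply/subsetP => x; rewrite inE => /mem_take; rewrite mem_enum.
Qed.

Let card_trim (S : {set V}) : (s <= #|S|)%N -> #|trim S| = s.
Proof.
move=> le; rewrite cardsE; have /card_uniqP -> : uniq (take s (enum S)).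
  by rewrite take_uniq// enum_uniq.
by rewrite size_takel// -cardE.
Qed.

Let cand_dis p p' f : p != p' -> [disjoint cand p f & cand p' f].
Proof.
case: p p' => [i a] [i' a'] pp'.
rewrite -setI_eq0; apply/eqP/setP => u; rewrite !inE.
apply/negP => /andP[/andP[uF /bigcupP[/= v vA fv]] /andP[_ /bigcupP[/= v' v'A fv']]].
move: fv fv'; rewrite !inE => /andP[/eqP fv _] /andP[/eqP fv' /forall_inP h].
have [e|ne] := eqVneq v v'; last first.
  by have := h _ (AUA vA); rewrite ne fv.
move: fv' v'A; rewrite -e fv => -[e'] vA'; rewrite -e' xpair_eqE eqxx andbT in pp'.
by have := disjointFr (disA pp') vA; rewrite vA'.
Qed.

Let sub_trim_dis (S S' : {set V}) : [disjoint S & S'] -> [disjoint trim S & trim S'].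
Proof.
move=> dis; apply: disjointWl (trim_sub _) _.
by apply: disjointWr (trim_sub _) _.
Qed.

(** All edges between the active sets [A i] and the fresh set [Fr] are revealed.
For each type [i] and useful label [a], the number of fresh vertices whose only
useful edge from the active sets comes from [A i] and has label [a] is a sum of
independent indicators, of mean at least [(1 + delta) * s], hence at least [s]
up to the Chebyshev error.  What follows only concerns edges that avoid the
active sets, which are still unrevealed. *)
Lemma certified_step (W : {set V}) (b : R)
    (C : (I * Om -> {set V}) -> {ffun E -> L} -> Prop) :
    (forall i, A i \subset W) -> Fr \subset W -> b <= 1 ->
    (forall B, offspring B -> certified (W :\: UA) b (C B)) ->
  certified W (b - #|{: I * Om}|%:R * ((1 + delta) / (delta ^+ 2 * s%:R)))
    (fun f => exists B, [/\ offspring B, linked f B & C B f]).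
Proof.
move=> sAW sFW b1 Cb.
have [b0|b0] := ltP b 0.
  apply: certified_le0; rewrite subr_le0; apply: le_trans (ltW b0) _.
  by rewrite mulr_ge0// divr_ge0 ?mulr_ge0 ?exprn_ge0 ?addr_ge0// ltW.
have UAW : UA \subset W by apply/bigcupsP => i _; exact: sAW.
have /choice[EvB HB] : forall B, exists Ev : {set {ffun E -> L}}, offspring B ->
    [/\ depends_on (between (W :\: UA) (W :\: UA)) Ev, b <= Pr w Ev
      & forall f, f \in Ev -> C B f].
  move=> B; have [oB|] := pselect (offspring B); last by exists set0.
  by have [Ev] := Cb _ oB; exists Ev.
pose Bf f (p : I * Om) := trim (cand p f).
have Bf_ok f : f \in many -> offspring (Bf f).
  rewrite inE => /forallP fm; split=> [p|p|p p' pp'].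
  - by apply: subset_trans (trim_sub _) _; apply/subsetP => u; rewrite inE => /andP[].
  - exact: card_trim.
  - by apply: sub_trim_dis; exact: cand_dis.
have dep_cand p (f g : {ffun E -> L}) : {in between UA Fr, f =1 g} -> cand p f = cand p g.
  move=> fg; apply/setP => u; rewrite [u \in cand p f]inE [u \in cand p g]inE.
  case: (boolP (u \in Fr)) => //= uF.
  apply: (@Z_dep p u) => e eu; apply: fg.
  by apply: (subsetP (betweenS (subxx _) _)) eu; rewrite sub1set.
have dep_many : depends_on (between UA Fr) many.
  by move=> f g fg; rewrite !inE; apply: eq_forallb => p; rewrite (dep_cand _ _ _ fg).
have dep_Bf (f g : {ffun E -> L}) : {in between UA Fr, f =1 g} -> EvB (Bf f) = EvB (Bf g).
  move=> fg; congr EvB; apply/funext => p; by rewrite /Bf (dep_cand _ _ _ fg).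
have disD : between (W :\: UA) (W :\: UA) \subset ~: between UA Fr.
  rewrite -disjoints_subset disjoint_sym; apply: between_disjoint;
  by rewrite disjoint_sym disjoints_subset; apply/subsetP => x; rewrite !inE => /andP[].
exists [set f in many | f \in EvB (Bf f)]; split.
- move=> f g fg.
  have fg1 : {in between UA Fr, f =1 g}.
    by move=> e eD; apply: fg; apply: (subsetP (betweenS _ _)) eD.
  have fg2 : {in between (W :\: UA) (W :\: UA), f =1 g}.
    move=> e eD; apply: fg; apply: (subsetP (betweenS _ _)) eD; exact: subsetDl.
  rewrite [LHS]inE [RHS]inE (dep_many _ _ fg1) (dep_Bf _ _ fg1).
  have [gm|//] := boolP (g \in many).
  by have [dE _ _] := HB _ (Bf_ok _ gm); rewrite (dE _ _ fg2).
- apply: le_trans (_ : b * Pr w many <= _).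
    apply: le_trans (_ : b * (1 - #|{: I * Om}|%:R *
      ((1 + delta) / (delta ^+ 2 * s%:R))) <= _); last by rewrite ler_wpM2l.
    rewrite mulrBr mulr1 lerD2l lerN2; apply: ler_piMl => //.
    rewrite mulr_ge0// divr_ge0 ?mulr_ge0 ?exprn_ge0 ?addr_ge0// ltW//.
  apply: (Pr_adaptive w_ge0 w_sum1 dep_many dep_Bf).
  + by move=> g /Bf_ok/HB[dE _ _]; apply: depends_onS dE.
  + by move=> g /Bf_ok/HB[].
- move=> f; rewrite inE => /andP[fm fE]; have oB := Bf_ok _ fm.
  exists (Bf f); split=> //; last by have [_ _] := HB _ oB; exact.
  move=> i a u /(subsetP (trim_sub _)); rewrite inE => /andP[_ /bigcupP[v vA]].
  by rewrite !inE => /andP[/eqP fv _]; exists v.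
Qed.

End Step.
End Exploration.

(** * Paths of bounded cost *)

Section Reach.
Local Open Scope set_scope.
Local Open Scope ring_scope.
Import fintype boot.finset.
Variables (V E : finType) (K : nat).
Implicit Types (edge : V -> V -> E) (f : {ffun E -> 'I_K.+1 * bool}).

(** An edge of class [c] costs at most [c.+1] units, and the top class [K] has no
upper bound: hence the successor and the exclusion of [K]. *)
Definition reach edge f (x : V) (U : {set V}) (v : V) (C r : nat) : Prop :=
  exists p : seq V,
    [/\ uniq (x :: p), last x p = v, {subset x :: p <= U},
        all (fun e => (f e).1 < K)%N (pairmap edge x p)
      & (\sum_(e <- pairmap edge x p) (f e).1.+1 <= C)%N /\
        (count (fun e => (f e).2) (pairmap edge x p) <= r)%N].

Lemma reach_refl edge f (x : V) (U : {set V}) : x \in U -> reach edge f x U x 0 0.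
Proof.
move=> xU; exists [::]; split=> //; first by move=> z; rewrite inE => /eqP ->.
by rewrite /= big_nil.
Qed.

Lemma reach_mono edge f (x v : V) (U U' : {set V}) (C C' r r' : nat) :
    U \subset U' -> (C <= C')%N -> (r <= r')%N ->
  reach edge f x U v C r -> reach edge f x U' v C' r'.
Proof.
move=> /subsetP sU CC rr [p [up lp sp Kp [Cp rp]]]; exists p; split=> //.
  by move=> z /sp /sU.
by split; [exact: leq_trans CC|exact: leq_trans rr].
Qed.

Lemma reach_extend edge f (x v u : V) (U U' : {set V}) (C r : nat) :
    reach edge f x U v C r -> u \notin U -> u \in U' -> U \subset U' ->
    ((f (edge v u)).1 < K)%N ->
  reach edge f x U' u (C + (f (edge v u)).1.+1) (r + (f (edge v u)).2).
Proof.
move=> [p [up lp sp Kp [Cp rp]]] uU uU' /subsetP sU Kvu; exists (rcons p u).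
have pE : pairmap edge x (rcons p u) = rcons (pairmap edge x p) (edge v u).
  by rewrite -cats1 pairmap_cat lp /= cats1.
split.
- rewrite -rcons_cons rcons_uniq up andbT; apply: contra uU; exact: sp.
- by rewrite last_rcons.
- by move=> z; rewrite -rcons_cons mem_rcons inE => /orP[/eqP ->//|/sp /sU].
- by rewrite pE all_rcons Kvu.
- rewrite pE -cats1 big_cat count_cat /= big_seq1 addn0.
  by split; rewrite leq_add.
Qed.

Lemma pairmap_rev edge (x : V) (p : seq V) :
  pairmap edge (last x p) (rev (belast x p)) =
  rev (pairmap (fun i j => edge j i) x p).
Proof.
elim/last_ind: p x => //= p y IH x; rewrite last_rcons belast_rcons.
rewrite -[rcons p y]cats1 pairmap_cat /= rev_cat /= -IH.
by rewrite (lastI x p) rev_rcons /=.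
Qed.

(** The second path was explored from its end [y] against the direction of the
edges, so it has to be reversed. *)
Lemma reach_join edge f (x y v u : V) (U1 U2 : {set V}) (C1 C2 r1 r2 : nat) :
    reach edge f x U1 v C1 r1 -> reach (fun i j => edge j i) f y U2 u C2 r2 ->
    [disjoint U1 & U2] -> ((f (edge v u)).1 < K)%N ->
  reach edge f x [set: V] y (C1 + C2 + K) (r1 + r2 + 1).
Proof.
move=> [p [up lp sp Kp [Cp rp]]] [q [uq lq sq Kq [Cq rq]]] dis Kvu.
have qE : rev (y :: q) = u :: rev (belast y q) by rewrite lastI rev_rcons lq.
have pE : pairmap edge x (p ++ rev (y :: q)) = pairmap edge x p ++
    edge v u :: rev (pairmap (fun i j => edge j i) y q).
  by rewrite pairmap_cat lp qE /= -pairmap_rev lq.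
exists (p ++ rev (y :: q)); split.
- rewrite -cat_cons cat_uniq up rev_uniq uq /= andbT.
  apply/hasPn => z; rewrite mem_rev => /sq zU2; apply/negP => /sp zU1.
  by rewrite (disjointFr dis zU1) in zU2.
- by rewrite last_cat rev_cons last_rcons.
- by move=> z _; rewrite inE.
- by rewrite pE all_cat Kp /= Kvu all_rev.
- rewrite pE big_cat big_cons count_cat /= count_rev.
  rewrite (perm_big _ (permEl (perm_rev _))) /=.
  split; first by rewrite addnA -addnA addnCA [leqRHS]addnC leq_add// leq_add.
  by rewrite -addnA leq_add// addnC leq_add// leq_b1.
Qed.

End Reach.

Section Cardinals.
Local Open Scope set_scope.
Local Open Scope ring_scope.
Import fintype boot.finset.

Lemma card_bigcup_disjoint (T I : finType) (P : {set I}) (A : I -> {set T}) (s : nat) :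
    (forall i, #|A i| = s) -> (forall i j, i != j -> [disjoint A i & A j]) ->
  #|\bigcup_(i in P) A i| = (#|P| * s)%N.
Proof.
move=> cA dA; rewrite -sum_nat_const.
pose B i := if i \in P then A i else set0.
transitivity #|\bigcup_i B i|; first by rewrite [in RHS]/B -big_mkcond.
rewrite -sum1_card partition_disjoint_bigcup; last first.
  move=> i j /dA dij; rewrite /B -setI_eq0.
  by case: ifP; case: ifP; rewrite ?set0I ?setI0// setI_eq0.
rewrite [RHS]big_mkcond; apply: eq_bigr => i _.
by rewrite sum1_card /B; case: ifP; rewrite ?cA ?cards0.
Qed.

Lemma card_bigcupT_disjoint (T I : finType) (A : I -> {set T}) (s : nat) :
    (forall i, #|A i| = s) -> (forall i j, i != j -> [disjoint A i & A j]) ->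
  #|\bigcup_i A i| = (#|I| * s)%N.
Proof.
move=> cA dA; rewrite -cardsT -(card_bigcup_disjoint [set: I] cA dA).
by under [in RHS]eq_bigl do rewrite inE.
Qed.

Lemma subset_of_card (T : finType) (A : {set T}) (s : nat) :
  (s <= #|A|)%N -> exists2 B : {set T}, B \subset A & #|B| = s.
Proof.
move=> sA; exists ([set x in take s (enum A)]).
  by apply/fintype.subsetP => x; rewrite inE => /mem_take; rewrite mem_enum.
rewrite cardsE; have /card_uniqP -> : uniq (take s (enum A)).
  by rewrite take_uniq// enum_uniq.
by rewrite size_takel// -cardE.
Qed.

End Cardinals.

(** * Growing a set of reached vertices *)

Section Blocks.
Local Open Scope set_scope.
Local Open Scope ring_scope.
Import fintype boot.finset.
Variables (R : realFieldType) (V E : finType) (K J k : nat).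
Local Notation L := ('I_K.+1 * bool)%type.
Local Notation Om := ('I_J.+1 * bool)%type.
Variables (w : E -> L -> R) (edge : V -> V -> E).
Hypothesis w_ge0 : forall e l, 0 <= w e l.
Hypothesis w_sum1 : forall e, \sum_l w e l = 1.
Hypothesis edge_inj : edge_injective edge.
Hypothesis J_lt : (J < K)%N.
Hypothesis k_gt0 : (0 < k)%N.

Definition short_label (l : L) : option Om :=
  if (l.1 <= J)%N then Some (inord l.1, l.2) else None.

(** The label of the first, the last and the joining edges of the path: they may
have any bounded class, and they are so few that their colour does not matter. *)
Definition cheap_label (l : L) : option unit :=
  if (l.1 < K)%N then Some tt else None.

Lemma short_labelE l a : short_label l = Some a ->
  (l.1 : nat) = a.1 :> nat /\ l.2 = a.2.
Proof.
rewrite /short_label; case: ifP => // lJ [<-] /=.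
by rewrite inordK.
Qed.

Variables (q Q delta : R).
Hypothesis q_ge0 : 0 <= q.
Hypothesis Q_ge0 : 0 <= Q.
Hypothesis q_le : forall i j a, i != j ->
  q <= \sum_(l | short_label l == Some a) w (edge i j) l.
Hypothesis Q_ge : forall i j, i != j ->
  \sum_(l | short_label l != None) w (edge i j) l <= Q.
Hypothesis delta_gt0 : 0 < delta.

Definition type_cost t (om : t.-tuple Om) : nat := \sum_(a <- om) a.1.+1.
Definition type_red t (om : t.-tuple Om) : nat := count (fun a : Om => a.2) om.

Definition typed_reach (x : V) (C r : nat) t (A : t.-tuple Om -> {set V})
    (U : {set V}) (f : {ffun E -> L}) : Prop :=
  forall om v, v \in A om ->
  reach edge f x U v (C + type_cost om) (r + type_red om).

Definition next_type t (B : t.-tuple Om * Om -> {set V}) (om : t.+1.-tuple Om) :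
  {set V} := B ([tuple of behead om], thead om).

Lemma next_typeE t (om : t.+1.-tuple Om) :
  (type_cost om = type_cost [tuple of behead om] + (thead om).1.+1)%N /\
  (type_red om = type_red [tuple of behead om] + (thead om).2)%N.
Proof.
rewrite /type_cost /type_red [in LHS](tuple_eta om) big_cons addnC.
by split=> //; rewrite [in LHS](tuple_eta om) /= addnC.
Qed.

Lemma pair_type_inj t (om om' : t.+1.-tuple Om) : om != om' ->
  ([tuple of behead om], thead om) != ([tuple of behead om'], thead om').
Proof.
apply: contraNneq => -[e1 e2]; rewrite (tuple_eta om) (tuple_eta om').
by apply/eqP/val_inj => /=; rewrite e1 e2.
Qed.

Definition step_error (h sigma : nat) : R :=
  (#|{: Om}| ^ h)%:R * ((1 + delta) / (delta ^+ 2 * sigma%:R)).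

Lemma step_error_ge0 h sigma : 0 <= step_error h sigma.
Proof.
rewrite /step_error mulr_ge0// divr_ge0 ?mulr_ge0 ?exprn_ge0 ?addr_ge0// ltW//.
Qed.

(** With [sigma] vertices per type at the end of a block of [h] generations, no
generation has more than [type_bound h * sigma] active vertices. *)
Definition type_bound (h : nat) : nat := #|{: Om}| ^ h * k ^ h.

Lemma card_Om_gt0 : (0 < #|{: Om}|)%N.
Proof. by rewrite card_prod card_ord card_bool. Qed.

(** The type of an active vertex is the list of labels read on the path that
reached it, latest first.  Each generation keeps exactly [1 / k] times as many
vertices in each type, but creates all one-label extensions of every type;
[j] counts the generations still to come in the block. *)
Lemma certified_generations (x : V) (C r : nat) (Goal : {ffun E -> L} -> Prop)
    (b : R) (h sigma F0 : nat) (Rest : {set V}) (j t : nat)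
    (A : t.-tuple Om -> {set V}) (Dn Fr : {set V}) :
    (j + t = h)%N -> (0 < sigma)%N -> b <= 1 ->
    1 + delta <= k%:R * q * F0%:R * (1 - (type_bound h * sigma)%:R * Q) ->
    (forall om, #|A om| = k ^ j * sigma)%N ->
    (forall om om', om != om' -> [disjoint A om & A om']) ->
    (forall om, A om \subset Dn) ->
    [disjoint Dn & Fr] -> [disjoint Dn & Rest] -> [disjoint Fr & Rest] ->
    (F0 + j * (type_bound h * sigma) <= #|Fr|)%N ->
    (forall (A' : h.-tuple Om -> {set V}) (Dn' Fr' : {set V}),
      (forall om, #|A' om| = sigma) ->
      (forall om om', om != om' -> [disjoint A' om & A' om']) ->
      (forall om, A' om \subset Dn') ->
      [disjoint Dn' & Fr'] -> Dn' \subset Dn :|: Fr -> Fr' \subset Fr ->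
      (#|Fr| <= #|Fr'| + j * (type_bound h * sigma))%N ->
      certified w edge ((\bigcup_om A' om) :|: Fr' :|: Rest) b
        (fun f => typed_reach x C r A' Dn' f -> Goal f)) ->
  certified w edge ((\bigcup_om A om) :|: Fr :|: Rest)
    (b - j%:R * step_error h sigma)
    (fun f => typed_reach x C r A Dn f -> Goal f).
Proof.
move=> jth sigma0 b1 growth; elim: j t A Dn Fr jth => [|j IH] t A Dn Fr jth.
  move=> cA dA sA dDF dDR dFR Fr0 cont; rewrite mul0r subr0.
  rewrite add0n in jth; move: A cA dA sA; rewrite jth => A cA dA sA.
  apply: cont => //; first by move=> om; rewrite cA expn0 mul1n.
    exact: subsetUl.
  by rewrite mul0n addn0.
move=> cA dA sA dDF dDR dFR Fr0 cont.
have th : (t < h)%N by rewrite -jth addSn ltnS leq_addl.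
have jh : (j < h)%N by rewrite -jth addSn ltnS leq_addr.
have cUA : (#|\bigcup_om A om| = #|{: Om}| ^ t * (k ^ j.+1 * sigma))%N.
  by rewrite (card_bigcupT_disjoint cA dA) card_tuple.
have UA_le : (#|\bigcup_om A om| <= type_bound h * sigma)%N.
  rewrite cUA /type_bound mulnA leq_mul// leq_mul//.
    by rewrite leq_pexp2l ?card_Om_gt0// ltnW.
  by rewrite leq_pexp2l.
have sDA om : [disjoint A om & Fr] by exact: disjointWl (sA om) dDF.
have tb0 : (0 < type_bound h * sigma)%N.
  by rewrite !muln_gt0 !expn_gt0 k_gt0 card_Om_gt0 sigma0.
have err1 : #|{: t.-tuple Om * Om}|%:R *
   ((1 + delta) / (delta ^+ 2 * (k ^ j * sigma)%:R)) <= step_error h sigma.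
  apply: ler_pM => //.
  - by rewrite divr_ge0 ?mulr_ge0 ?exprn_ge0 ?addr_ge0// ltW.
  - by rewrite ler_nat card_prod card_tuple mulnC -expnS leq_pexp2l ?card_Om_gt0.
  rewrite ler_wpM2l ?addr_ge0 ?(ltW delta_gt0)// lef_pV2 ?posrE; last 2 first.
  - by rewrite mulr_gt0 ?exprn_gt0// ltr0n muln_gt0 expn_gt0 k_gt0.
  - by rewrite mulr_gt0 ?exprn_gt0// ltr0n.
  rewrite ler_wpM2l ?exprn_ge0 ?(ltW delta_gt0)// ler_nat leq_pmull//.
  by rewrite expn_gt0 k_gt0.
have gr om : (1 + delta) * (k ^ j * sigma)%:R <=
    #|A om|%:R * q * #|Fr|%:R * (1 - #|\bigcup_om A om|%:R * Q).
  have g0 : 0 < 1 - (type_bound h * sigma)%:R * Q.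
    have := lt_le_trans (addr_gt0 ltr01 delta_gt0) growth.
    by rewrite pmulr_rgt0// lt_neqAle eq_sym; case: eqVneq growth => [->|_ _];
      rewrite ?mul0r ?mulr_ge0// => /(lt_le_trans (addr_gt0 ltr01 delta_gt0)); rewrite ltxx.
  apply: le_trans (_ : k%:R * q * F0%:R * (1 - (type_bound h * sigma)%:R * Q)
     * (k ^ j * sigma)%:R <= _); first by rewrite ler_wpM2r.
  rewrite cA expnS -mulnA (natrM _ k).
  rewrite (_ : _ * (k ^ j * sigma)%:R = k%:R * (k ^ j * sigma)%:R * q *
    (F0%:R * (1 - (type_bound h * sigma)%:R * Q))); last by ring.
  rewrite -[leRHS]mulrA ler_wpM2l ?mulr_ge0// ler_pM ?(ltW g0)//.
    by rewrite ler_nat; apply: leq_trans Fr0; exact: leq_addr.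
  by rewrite lerD2l lerN2 ler_wpM2r// ler_nat.
have st : (0 < k ^ j * sigma)%N by rewrite muln_gt0 expn_gt0 k_gt0.
have step := @certified_step R V E _ w edge w_ge0 w_sum1 edge_inj Om _ short_label q Q
  delta A Fr (k ^ j * sigma) q_ge0 q_le Q_ge dA sDA delta_gt0 st gr
  ((\bigcup_om A om) :|: Fr :|: Rest) (b - j%:R * step_error h sigma)
  (fun B f => typed_reach x C r (next_type B) (Dn :|: \bigcup_p B p) f -> Goal f).
apply: (certified_mono _ _ _ (step _ _ _ _)); last 4 first.
- by move=> om; rewrite -setUA; apply: subset_trans (subsetUl _ _); apply/bigcup_sup.
- by rewrite setUAC subsetUr.
- by rewrite lerBlDr ler_wpDr// mulr_ge0// step_error_ge0.
- move=> B [sB cB dB].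
  have sUB : \bigcup_p B p \subset Fr by apply/bigcupsP => p _.
  have cUB : (#|\bigcup_p B p| <= type_bound h * sigma)%N.
    rewrite (_ : #|_| = #|{: t.-tuple Om * Om}| * (k ^ j * sigma))%N.
      rewrite card_prod card_tuple -expnSr /type_bound mulnA.
      by rewrite leq_mul// leq_mul// leq_pexp2l ?card_Om_gt0// ltnW.
    exact: card_bigcupT_disjoint.
  have cF : (#|Fr| = #|Fr :\: \bigcup_p B p| + #|\bigcup_p B p|)%N.
    by rewrite cardsD (setIidPr sUB) subnK// subset_leq_card.
  have sUn : \bigcup_om next_type B om \subset \bigcup_p B p.
    by apply/bigcupsP => om _; apply: (bigcup_sup ([tuple of behead om], thead om)).
  apply: certified_mono (IH t.+1 (next_type B) (Dn :|: \bigcup_p B p)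
    (Fr :\: \bigcup_p B p) _ _ _ _ _ _ _ _ _) => //.
  + rewrite !subUset !subsetD -!setUA; apply/andP; split; first (apply/andP; split).
    * apply/andP; split.
        apply: subset_trans sUn _; apply: subset_trans sUB _.
        by rewrite setUCA subsetUl.
      apply: disjointWl sUn _; apply: disjointWl sUB _; rewrite disjoint_sym.
      by rewrite -setI_eq0 big_distrl /=; apply/eqP; rewrite big1// => om _; apply/eqP; rewrite setI_eq0.
    * apply/andP; split; first by apply: subset_trans (subsetDl _ _) _; rewrite setUCA subsetUl.
      apply: disjointWl (subsetDl _ _) _; rewrite disjoint_sym.
      by rewrite -setI_eq0 big_distrl /=; apply/eqP; rewrite big1// => om _; apply/eqP; rewrite setI_eq0.
    * apply/andP; split; first by rewrite setUA subsetUr.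
      rewrite disjoint_sym; apply: disjointWl dDR.
      by apply/bigcupsP => om _.
  + by rewrite addnS -addSn.
  + by move=> om; rewrite cB.
  + by move=> om om' ne; apply: dB; exact: pair_type_inj.
  + by move=> om; apply: subset_trans (subsetUr _ _);
    apply: (bigcup_sup ([tuple of behead om], thead om)).
  + rewrite -setI_eq0 setIUl setU_eq0 !setI_eq0; apply/andP; split.
      exact: disjointWr (subsetDl _ _) dDF.
    by rewrite -setI_eq0 setIDA setDIl setDv set0I.
  + rewrite -setI_eq0 setIUl setU_eq0 !setI_eq0 dDR /=.
    exact: disjointWl sUB dFR.
  + exact: disjointWl (subsetDl _ _) dFR.
  + rewrite mulSn addnCA in Fr0.
    by rewrite -(leq_add2r #|\bigcup_p B p|) -cF; apply: leq_trans Fr0; rewrite addnC leq_add2r.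
  + move=> A' Dn' Fr' cA' dA' sA' dDF' sDn' sFr' cFr'; apply: cont => //.
    * apply: subset_trans sDn' _; rewrite !subUset subsetUl/=.
      apply/andP; split; last by apply: subset_trans (subsetDl _ _) (subsetUr _ _).
      exact: subset_trans sUB (subsetUr _ _).
    * exact: subset_trans sFr' (subsetDl _ _).
    * by rewrite cF mulSn addnCA addnC leq_add.
- exact: subxx.
- by rewrite -addn1 natrD mulrDl mul1r opprD addrA lerD2l lerN2.
- move=> f [B [oB lB CB]] Af; apply: CB => om u uB.
  have [v vA /short_labelE[e1 e2]] := lB _ _ _ uB.
  have [-> ->] := next_typeE om; rewrite !addnA -e1 -e2.
  have [sB _ _] := oB.
  apply: reach_extend (Af _ _ vA) _ _ _ _.
  + have /subsetP/(_ _ uB) uF := sB ([tuple of behead om], thead om).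
    by rewrite (disjointFl dDF uF).
  + by rewrite inE; apply/orP; right; apply/bigcupP; exists ([tuple of behead om], thead om).
  + exact: subsetUl.
  + by rewrite e1; apply: leq_ltn_trans J_lt; rewrite -ltnS.
Qed.

Definition all_reach (x : V) (C r : nat) (S U : {set V}) (f : {ffun E -> L}) : Prop :=
  forall v, v \in S -> reach edge f x U v C r.

Section Iterate.
Variables (h r0 m0 : nat).

Definition light_types : {set h.-tuple Om} :=
  [set om : h.-tuple Om | (\sum_(a <- om) a.1 <= J)%N
                        & (count (fun a : Om => a.2) om <= r0)%N].

Hypothesis m0_le : (m0 * k ^ h <= #|light_types|)%N.
Hypothesis m0_ge2 : (1 < m0)%N.

Lemma light_cost om : om \in light_types ->
  (type_cost om <= J + h)%N /\ (type_red om <= r0)%N.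
Proof.
rewrite inE => /andP[om1 om2]; split=> //; rewrite /type_cost.
under eq_bigr do rewrite -addn1.
by rewrite big_split /= leq_add// sum1_size size_tuple.
Qed.

(** The light types are at least [m0 * k ^ h] in number and hold [sigma] vertices
each at the end of the block.  Their union thus has at least [m0] times as many
vertices as the initial set [S], all reached within the budget of the block. *)
Lemma certified_block (x : V) (C r : nat) (Goal : {ffun E -> L} -> Prop)
    (b : R) (sigma F0 : nat) (Rest S Dn Fr : {set V}) :
    (0 < sigma)%N -> b <= 1 ->
    1 + delta <= k%:R * q * F0%:R * (1 - (type_bound h * sigma)%:R * Q) ->
    (#|S| = k ^ h * sigma)%N -> S \subset Dn ->
    [disjoint Dn & Fr] -> [disjoint Dn & Rest] -> [disjoint Fr & Rest] ->
    (F0 + h * (type_bound h * sigma) <= #|Fr|)%N ->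
    (forall S' Dn' Fr' : {set V},
      (#|S'| = k ^ h * (sigma * m0))%N -> S' \subset Dn' ->
      [disjoint Dn' & Fr'] -> Dn' \subset Dn :|: Fr -> Fr' \subset Fr ->
      (#|Fr| <= #|Fr'| + h * (type_bound h * sigma))%N ->
      certified w edge (S' :|: Fr' :|: Rest) b
        (fun f => all_reach x (C + (J + h)) (r + r0) S' Dn' f -> Goal f)) ->
  certified w edge (S :|: Fr :|: Rest) (b - h%:R * step_error h sigma)
    (fun f => all_reach x C r S Dn f -> Goal f).
Proof.
move=> sigma0 b1 growth cS sS dDF dDR dFR Fr0 cont.
have bigS : \bigcup_(om : 0.-tuple Om) S = S.
  apply/setP => v; apply/bigcupP/idP => [[]//|vS].
  by exists [tuple].
rewrite -[in X in certified _ _ X]bigS.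
apply: certified_mono (certified_generations (x := x) (C := C) (r := r)
  (Goal := Goal) (j := h) (A := fun _ => S) _ sigma0 b1 growth
  _ _ _ dDF dDR dFR Fr0 _) => //.
- exact: subxx.
- move=> f H Sf; apply: H => om v vS; rewrite tuple0 /type_cost /type_red /=.
  by rewrite big_nil !addn0; exact: Sf.
- by rewrite addn0.
- by move=> om om'; rewrite (tuple0 om) (tuple0 om') eqxx.
move=> A Dn' Fr' cA dA sA dDF' sDn' sFr' cFr'.
have cU := card_bigcup_disjoint light_types cA dA.
have [S' sS' cS'] : exists2 S' : {set V},
    S' \subset \bigcup_(om in light_types) A om &
    #|S'| = (k ^ h * (sigma * m0))%N.
  apply: subset_of_card; rewrite cU mulnCA mulnC leq_mul2r mulnC m0_le.
  by rewrite orbT.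
have sS'U : S' \subset \bigcup_om A om.
  apply: subset_trans sS' _; apply/bigcupsP => om _; exact: bigcup_sup.
apply: certified_mono (cont S' Dn' Fr' cS' _ dDF' sDn' sFr' cFr').
- by rewrite !setUSS.
- by [].
- move=> f H Af; apply: H => v /(subsetP sS')/bigcupP[om omG vA].
  have [c1 c2] := light_cost omG.
  by apply: reach_mono (Af om v vA); rewrite ?leq_add2l.
- apply: subset_trans sS' _; apply/bigcupsP => om _; exact: sA.
Qed.

Lemma step_error_mul sigma : (0 < sigma)%N ->
  2 * step_error h (sigma * m0) <= step_error h sigma.
Proof.
move=> s0; rewrite /step_error mulrCA ler_wpM2l//.
have d20 : 0 < delta ^+ 2 by rewrite exprn_gt0.
rewrite mulrA ler_pdivrMr ?mulr_gt0 ?ltr0n ?muln_gt0 ?s0 ?(ltnW m0_ge2)//.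
rewrite mulrAC ler_pdivlMr ?mulr_gt0 ?ltr0n// natrM.
have le2 : 2 <= m0%:R :> R by rewrite ler_nat.
have p0 : 0 <= (1 + delta) * (delta ^+ 2 * sigma%:R).
  by rewrite !mulr_ge0// ?addr_ge0// ltW.
have := ler_wpM2l p0 le2; lra.
Qed.

(** The error of a block is inversely proportional to [sigma], which is multiplied
by [m0 >= 2] in each block: the errors are dominated by a geometric series. *)
Lemma certified_blocks (x : V) (Goal : {ffun E -> L} -> Prop)
    (b : R) (F0 Z m : nat) (Rest : {set V}) :
    b <= 1 ->
    1 + delta <= k%:R * q * F0%:R * (1 - Z%:R * Q) ->
  forall (C r sigma : nat) (S Dn Fr : {set V}),
    (0 < sigma)%N -> (type_bound h * (sigma * m0 ^ m) <= Z)%N ->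
    (#|S| = k ^ h * sigma)%N -> S \subset Dn ->
    [disjoint Dn & Fr] -> [disjoint Dn & Rest] -> [disjoint Fr & Rest] ->
    (F0 + m * (h * Z) <= #|Fr|)%N ->
    (forall S' Dn' Fr' : {set V},
      (#|S'| = k ^ h * (sigma * m0 ^ m))%N -> S' \subset Dn' ->
      [disjoint Dn' & Fr'] -> Dn' \subset Dn :|: Fr -> Fr' \subset Fr ->
      (#|Fr| <= #|Fr'| + m * (h * Z))%N ->
      certified w edge (S' :|: Fr' :|: Rest) b
        (fun f => all_reach x (C + m * (J + h)) (r + m * r0) S' Dn' f -> Goal f)) ->
  certified w edge (S :|: Fr :|: Rest) (b - h%:R * (2 * step_error h sigma))
    (fun f => all_reach x C r S Dn f -> Goal f).
Proof.
move=> b1 growth; elim: m => [|m IH] C r sigma S Dn Fr s0 sZ cS sS dDF dDR dFR Fr0 cont.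
  apply: certified_mono (cont S Dn Fr _ sS dDF _ _ _) => //.
  - by rewrite gerBl mulr_ge0// mulr_ge0// step_error_ge0.
  - by move=> f; rewrite !mul0n !addn0.
  - by rewrite expn0 muln1.
  - exact: subsetUl.
  - by rewrite mul0n addn0.
have sm0 : (0 < sigma * m0)%N by rewrite muln_gt0 s0 ltnW.
have sZ1 : (type_bound h * sigma <= Z)%N.
  by apply: leq_trans sZ; rewrite leq_mul2l leq_pmulr ?orbT// expn_gt0 (ltnW m0_ge2).
have step_le : (h * (type_bound h * sigma) <= h * Z)%N by rewrite leq_mul2l sZ1 orbT.
apply: certified_mono (certified_block (x := x) (C := C) (r := r) (Goal := Goal)
  (b := b - h%:R * (2 * step_error h (sigma * m0))) (F0 := F0) s0 _ _ cS sS
  dDF dDR dFR _ _) => //.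
- rewrite -addrA lerD2l -opprD lerN2 -mulrDr ler_wpM2l//.
  by have := step_error_mul s0; lra.
- by apply: le_trans b1; rewrite gerBl mulr_ge0// mulr_ge0// step_error_ge0.
- apply: le_trans growth _; rewrite ler_wpM2l ?mulr_ge0// lerD2l lerN2.
  by rewrite ler_wpM2r// ler_nat.
- apply: leq_trans Fr0; rewrite leq_add2l mulSn; apply: leq_trans step_le _.
  exact: leq_addr.
move=> S' Dn' Fr' cS' sS' dDF' sDn' sFr' cFr'.
apply: IH => //.
- by rewrite -mulnA -expnS.
- rewrite -setI_eq0; apply/eqP/setP => v; rewrite !inE; apply/andP => -[vD vR].
  have := subsetP sDn' _ vD; rewrite inE => /orP[vDn|vF].
    by rewrite (disjointFr dDR vDn) in vR.
  by rewrite (disjointFr dFR vF) in vR.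
- exact: disjointWl sFr' dFR.
- rewrite -(leq_add2r (h * (type_bound h * sigma))); apply: leq_trans cFr'.
  apply: leq_trans Fr0; rewrite mulSn [(h * Z + _)%N]addnC addnA leq_add2l.
  exact: step_le.
move=> S2 Dn2 Fr2 cS2 sS2 dDF2 sDn2 sFr2 cFr2.
apply: certified_mono (cont S2 Dn2 Fr2 _ sS2 dDF2 _ _ _) => //.
- by move=> f; rewrite !mulSn !addnA.
- by rewrite cS2 -mulnA -expnS.
- apply: subset_trans sDn2 _; rewrite subUset sDn' /=.
  exact: subset_trans sFr' (subsetUr _ _).
- exact: subset_trans sFr2 sFr'.
- apply: leq_trans cFr' _; rewrite mulSn addnCA addnC leq_add//.
Qed.

End Iterate.

Section Explore.
Variables (h r0 m0 : nat) (q' Q' : R).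
Hypothesis m0_le : (m0 * k ^ h <= #|light_types h r0|)%N.
Hypothesis m0_ge2 : (1 < m0)%N.
Hypothesis q'_ge0 : 0 <= q'.
Hypothesis Q'_ge0 : 0 <= Q'.
Hypothesis q'_le : forall i j, i != j ->
  q' <= \sum_(l | cheap_label l == Some tt) w (edge i j) l.
Hypothesis Q'_ge : forall i j, i != j ->
  \sum_(l | cheap_label l != None) w (edge i j) l <= Q'.

Lemma cheap_labelE l : cheap_label l = Some tt -> (l.1 < K)%N.
Proof. by rewrite /cheap_label; case: ifP. Qed.

Lemma certified_cheap_edges (A Fr W : {set V}) (s : nat) (b : R)
    (C : {set V} -> {ffun E -> L} -> Prop) :
    (0 < s)%N -> [disjoint A & Fr] -> A \subset W -> Fr \subset W -> b <= 1 ->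
    2 * s%:R <= #|A|%:R * q' * #|Fr|%:R * (1 - #|A|%:R * Q') ->
    (forall B : {set V}, B \subset Fr -> #|B| = s ->
      certified w edge (W :\: A) b (C B)) ->
  certified w edge W (b - 2 / s%:R)
    (fun f => exists B : {set V}, [/\ B \subset Fr, #|B| = s,
       forall u, u \in B -> exists2 v, v \in A & ((f (edge v u)).1 < K)%N
     & C B f]).
Proof.
move=> s0 dAF sAW sFW b1 gr cont.
have bigA : \bigcup_(i : unit) A = A.
  by apply/setP => v; apply/bigcupP/idP => [[]//|vA]; exists tt.
have step := @certified_step R V E _ w edge w_ge0 w_sum1 edge_inj unit unit
  cheap_label q' Q' 1 (fun _ => A) Fr s q'_ge0 _ Q'_ge _ (fun _ => dAF) ltr01 s0 _
  W b (fun B f => C (B (tt, tt)) f).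
apply: (certified_mono _ _ _ (step _ _ _ _ _ _ _)) => //.
- rewrite lerD2l lerN2 card_prod card_unit mul1r expr1n mul1r.
  by rewrite ler_wpM2r ?invr_ge0.
- move=> f [B [[sB cB _] lB CB]]; exists (B (tt, tt)); split=> // u /lB[v vA e].
  by exists v => //; exact: cheap_labelE.
- by move=> i j [] ij; exact: q'_le.
- by move=> _; rewrite bigA.
- by move=> B [sB cB _]; rewrite bigA; apply: cont; rewrite ?sB ?cB.
Qed.

(** Blocks alone would fail with a probability bounded away from 0 if they started
from the single vertex [x].  A cheap edge from [x] first provides
[k ^ h * sigma] vertices, at the cost of one possibly red edge. *)
Lemma certified_explore (x : V) (Goal : {ffun E -> L} -> Prop)
    (b : R) (sigma F0 Z m : nat) (Rest Fr : {set V}) :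
    b <= 1 -> (0 < sigma)%N ->
    1 + delta <= k%:R * q * F0%:R * (1 - Z%:R * Q) ->
    2 * (k ^ h * sigma)%:R <= q' * #|Fr|%:R * (1 - Q') ->
    (type_bound h * (sigma * m0 ^ m) <= Z)%N ->
    x \notin Fr -> x \notin Rest -> [disjoint Fr & Rest] ->
    (F0 + (k ^ h * sigma + m * (h * Z)) <= #|Fr|)%N ->
    (forall S Dn Fr' : {set V},
      (#|S| = k ^ h * (sigma * m0 ^ m))%N -> S \subset Dn ->
      [disjoint Dn & Fr'] -> Dn \subset x |: Fr -> Fr' \subset Fr ->
      (#|Fr| <= #|Fr'| + (k ^ h * sigma + m * (h * Z)))%N ->
      certified w edge (S :|: Fr' :|: Rest) b
        (fun f => all_reach x (K + m * (J + h)) (1 + m * r0) S Dn f -> Goal f)) ->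
  certified w edge (x |: Fr :|: Rest)
    (b - h%:R * (2 * step_error h sigma) - 2 / (k ^ h * sigma)%:R) Goal.
Proof.
move=> b1 s0 growth gr0 sZ xF xR dFR Fr0 cont.
have ks0 : (0 < k ^ h * sigma)%N by rewrite muln_gt0 expn_gt0 k_gt0.
apply: (certified_mono _ _ _ (certified_cheap_edges (A := [set x]) (Fr := Fr)
  (C := fun B f => all_reach x K 1 B (x |: B) f -> Goal f) ks0 _ _ _ _ _ _)).
- exact: subxx.
- exact: lexx.
- move=> f [B [sB cB lB]]; apply=> u uB; have [v /set1P -> fK] := lB u uB.
  apply: reach_mono (reach_extend (U := [set x]) (U' := x |: B)
    (C := 0) (r := 0) _ _ _ _ fK).
  + exact: subxx.
  + by rewrite add0n.
  + by rewrite add0n leq_b1.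
  + by apply: reach_refl; rewrite inE.
  + by rewrite inE; apply: contraNneq xF => <-; exact: (subsetP sB).
  + by rewrite !inE uB orbT.
  + exact: subsetUl.
- by rewrite disjoints1.
- by rewrite -setUA subsetUl.
- by rewrite setUAC subsetUr.
- by apply: le_trans b1; rewrite gerBl mulr_ge0// mulr_ge0// step_error_ge0.
- by rewrite cards1 !mul1r.
move=> B sB cB.
have cF : (#|Fr| = #|Fr :\: B| + k ^ h * sigma)%N.
  by rewrite cardsD (setIidPr sB) -cB subnK// subset_leq_card.
apply: certified_mono (certified_blocks m0_le m0_ge2 (x := x) (Goal := Goal)
  (Rest := Rest) b1 growth (S := B) (Dn := x |: B) (Fr := Fr :\: B) (C := K)
  (r := 1) s0 sZ _ _ _ _ _ _ _) => //.
- apply/subsetP => v vU; have vFR : v \in Fr :|: Rest.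
    move: vU; rewrite !inE -orbA => /or3P[/(subsetP sB) ->//|/andP[_ ->]//|->].
    by rewrite orbT.
  rewrite in_setD1 -setUA [in X in _ && X]inE vFR orbT andbT.
  apply: contraTneq vFR => ->; rewrite inE negb_or xF; exact: xR.
- by rewrite subsetUr.
- rewrite -setI_eq0 setIUl setU_eq0 !setI_eq0 disjoints1 inE negb_and xF orbT/=.
  by rewrite -setI_eq0 setIDA setDIl setDv set0I.
- rewrite -setI_eq0 setIUl setU_eq0 !setI_eq0 disjoints1 xR/=.
  exact: disjointWl sB dFR.
- exact: disjointWl (subsetDl _ _) dFR.
- by rewrite -(leq_add2r (k ^ h * sigma)) -cF; apply: leq_trans Fr0; rewrite addnC addnCA leq_add2l addnC.
move=> S Dn Fr' cS sS dDF sDn sFr' cFr'.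
apply: cont => //.
- apply: subset_trans sDn _; rewrite -setUA setUS// subUset sB /=.
  exact: subsetDl.
- exact: subset_trans sFr' (subsetDl _ _).
- by rewrite cF addnCA addnC leq_add2l.
Qed.

End Explore.
End Blocks.

(** * Joining two growing sets *)

Section Connection.
Local Open Scope set_scope.
Local Open Scope ring_scope.
Import fintype boot.finset.
Variables (R : realFieldType) (V E : finType) (K J k : nat).
Local Notation L := ('I_K.+1 * bool)%type.
Variables (w : E -> L -> R) (edge : V -> V -> E).
Hypothesis w_ge0 : forall e l, 0 <= w e l.
Hypothesis w_sum1 : forall e, \sum_l w e l = 1.
Hypothesis edge_inj : edge_injective edge.

Let flip i j := edge j i.

Let flip_inj : edge_injective flip.
Proof. by move=> i j i' j' /edge_inj[[-> ->]|[-> ->]]; [left|right]. Qed.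

Let certified_flip (W : {set V}) (b : R) (C : {ffun E -> L} -> Prop) :
  certified w flip W b C <-> certified w edge W b C.
Proof.
have betweenE : between flip W W = between edge W W.
  by apply/setP => e; apply/imset2P/imset2P => -[i j iW jW ->];
    exists j i.
by rewrite /certified betweenE.
Qed.

(** The second exploration grows [S2] backwards from [y], in what the exploration
from [x] left unrevealed.  The edges between its outcome [S1] and [S2] are then
still unrevealed, and so many that a cheap one is likely. *)
Lemma certified_connection (x y : V) (q Q q' Q' delta : R)
    (h r0 m0 sigma F0 Z m : nat) :
    x != y -> (J < K)%N -> (0 < k)%N -> (0 < sigma)%N -> (1 < m0)%N ->
    (m0 * k ^ h <= #|light_types J h r0|)%N ->
    0 < delta -> 0 <= q -> 0 <= Q -> 0 <= q' -> 0 <= Q' ->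
    (forall i j a, i != j ->
      q <= \sum_(l | short_label J l == Some a) w (edge i j) l) ->
    (forall i j, i != j ->
      \sum_(l | short_label J l != None) w (edge i j) l <= Q) ->
    (forall i j, i != j ->
      q' <= \sum_(l | cheap_label l == Some tt) w (edge i j) l) ->
    (forall i j, i != j ->
      \sum_(l | cheap_label l != None) w (edge i j) l <= Q') ->
    1 + delta <= k%:R * q * F0%:R * (1 - Z%:R * Q) ->
    2 * (k ^ h * sigma)%:R <= q' * F0%:R * (1 - Q') ->
    2 * sigma%:R <= (k ^ h * (sigma * m0 ^ m))%:R * q' *
      (k ^ h * (sigma * m0 ^ m))%:R * (1 - (k ^ h * (sigma * m0 ^ m))%:R * Q') ->
    (type_bound J k h * (sigma * m0 ^ m) <= Z)%N ->
    (F0 + (k ^ h * sigma + m * (h * Z)) * 2 + 2 <= #|V|)%N ->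
  certified w edge [set: V]
    (1 - (2 / sigma%:R + (h%:R * (2 * step_error J delta h sigma) +
      2 / (k ^ h * sigma)%:R) * 2))
    (fun f => reach edge f x [set: V] y
      ((K + m * (J + h)) * 2 + K) ((1 + m * r0) * 2 + 1)).
Proof.
move=> xy JK k0 s0 m02 m0le d0 q0 Q0 q'0 Q'0 qle Qge q'le Q'ge growth gr0 gr1 sZ F0V.
set B := (k ^ h * sigma + m * (h * Z))%N in F0V.
set err := h%:R * _ + _.
have err0 : 0 <= err by rewrite addr_ge0// ?divr_ge0// mulr_ge0// mulr_ge0// step_error_ge0.
pose Fr0 := [set: V] :\ x :\ y.
have cFr0 : (F0 + B + B <= #|Fr0|)%N.
  have := cardsD1 y ([set: V] :\ x); have := cardsD1 x [set: V].
  rewrite !inE cardsT eq_sym xy /= -/Fr0 => c1 c2; move: F0V; rewrite c1 c2.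
  by rewrite muln2 -addnn addnA !addnS addn0 !ltnS.
have gr0' F : (F0 <= F)%N -> 2 * (k ^ h * sigma)%:R <= q' * F%:R * (1 - Q').
  move=> F0F; have [p|p] := leP 0 (1 - Q').
    by apply: le_trans gr0 _; rewrite ler_wpM2r// ler_wpM2l// ler_nat.
  have : 2 * (k ^ h * sigma)%:R <= 0 :> R.
    by apply: le_trans gr0 _; rewrite mulr_ge0_le0// ?mulr_ge0// ltW.
  by rewrite leNgt mulr_gt0// ltr0n muln_gt0 expn_gt0 k0.
apply: (certified_mono _ _ _ (certified_explore w_ge0 w_sum1 edge_inj JK k0 q0 Q0
  qle Qge d0 m0le m02 q'0 q'le Q'ge (x := x) (b := 1 - 2 / sigma%:R - err)
  (sigma := sigma) (F0 := F0) (Z := Z) (m := m) (Rest := [set y]) (Fr := Fr0)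
  _ s0 growth _ sZ _ _ _ _ _)).
- exact: subsetT.
- rewrite /err; lra.
- by move=> f; exact.
- have : 0 <= 2 / sigma%:R :> R by rewrite divr_ge0.
  lra.
- by apply: gr0'; apply: leq_trans cFr0; rewrite -addnA leq_addr.
- by rewrite !inE eqxx andbF.
- by rewrite inE.
- by rewrite disjoint_sym disjoints1 !inE eqxx.
- by apply: leq_trans cFr0; rewrite leq_addr.
move=> S1 D1 Fr1 cS1 sS1 dDF1 sD1 sFr1 cFr1.
have cFr1' : (F0 + B <= #|Fr1|)%N.
  by rewrite -(leq_add2r B); apply: leq_trans cFr1.
have yF : y \notin Fr1.
  by apply/negP => /(subsetP sFr1); rewrite !inE eqxx.
have yD : y \notin D1.
  apply/negP => /(subsetP sD1); rewrite !inE eqxx /= orbF eq_sym.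
  by rewrite (negbTE xy).
apply/certified_flip.
apply: (certified_mono _ _ _ (certified_explore w_ge0 w_sum1 flip_inj JK k0 q0 Q0
  _ _ d0 m0le m02 q'0 _ _ (x := y) (b := 1 - 2 / sigma%:R)
  (sigma := sigma) (F0 := F0) (Z := Z) (m := m) (Rest := S1) (Fr := Fr1)
  _ s0 growth _ sZ _ _ _ _ _)).
- by rewrite setUC (setUC [set y]) setUA.
- rewrite /err; lra.
- by move=> f; exact.
- by move=> i j a ij; apply: qle; rewrite eq_sym.
- by move=> i j ij; apply: Qge; rewrite eq_sym.
- by move=> i j ij; apply: q'le; rewrite eq_sym.
- by move=> i j ij; apply: Q'ge; rewrite eq_sym.
- have : 0 <= 2 / sigma%:R :> R by rewrite divr_ge0.
  lra.
- by apply: gr0'; apply: leq_trans cFr1'; rewrite leq_addr.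
- exact: yF.
- by apply: contra yD; exact: (subsetP sS1).
- by rewrite disjoint_sym; exact: disjointWl sS1 dDF1.
- exact: cFr1'.
move=> S2 D2 Fr2 cS2 sS2 dDF2 sD2 sFr2 cFr2.
have dD : [disjoint D1 & D2].
  apply: disjointWr sD2 _; rewrite -setI_eq0 setIUr setU_eq0 !setI_eq0 dDF1 andbT.
  by rewrite disjoint_sym disjoints1.
apply/certified_flip.
apply: (certified_mono _ _ _ (certified_cheap_edges w_ge0 w_sum1 edge_inj q'0 q'le
  Q'ge (A := S1) (Fr := S2) (W := S2 :|: Fr2 :|: S1) (s := sigma) (b := 1)
  (C := fun _ _ => True) s0 _ _ _ _ _ _)).
- exact: subxx.
- by [].
- move=> f [S [sS cS lS _]] H2 H1.
  have [u uS] : exists u, u \in S by apply/card_gt0P; rewrite cS.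
  have [v vS1 fK] := lS u uS.
  apply: reach_mono (reach_join (H1 v vS1) (H2 u _) dD fK) => //.
  + by rewrite muln2 addnn.
  + by rewrite muln2 addnn.
  + exact: (subsetP sS).
- by apply: disjointWl sS1 _; apply: disjointWr sS2 _.
- exact: subsetUr.
- by rewrite -setUA subsetUl.
- by [].
- by rewrite cS1 cS2.
- by move=> S _ _; exact: certified_true.
Qed.

End Connection.

(** * Rate equation and growth of one block *)

Section Counting.
Local Open Scope set_scope.
Local Open Scope ring_scope.
Import fintype boot.finset.

Lemma card_light_types (J h r : nat) :
  ('C(h + J, h) * 'C(h, r) <= #|light_types J h r|)%N.
Proof.
pose PA := [set t : h.-tuple 'I_J.+1 | (\sum_(i <- t) i <= J)%N].
pose PB := [set A : {set 'I_h} | #|A| == r].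
pose F (p : h.-tuple 'I_J.+1 * {set 'I_h}) : h.-tuple ('I_J.+1 * bool) :=
  [tuple (tnth p.1 i, i \in p.2) | i < h].
have F_inj : injective F.
  case=> [t A] [t' A'] eF.
  have eFi i : tnth t i = tnth t' i /\ (i \in A) = (i \in A').
    by have := congr1 (fun u => tnth u i) eF; rewrite !tnth_mktuple /= => -[-> ->].
  congr pair; first by apply: eq_from_tnth => i; have [] := eFi i.
  by apply/setP => i; have [] := eFi i.
have <- : (#|setX PA PB| = 'C(h + J, h) * 'C(h, r))%N.
  by rewrite cardsX card_partial_ord_partitions card_draws card_ord.
rewrite -(card_imset _ F_inj); apply: subset_leq_card.
apply/subsetP => _ /imsetP[[t A] tA ->]; move: tA; rewrite !inE /= => /andP[tJ Ar].
apply/andP; split.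
  rewrite big_map big_enum /=; apply: leq_trans tJ.
  by rewrite [leqRHS]big_tuple.
rewrite count_map -sum1_count big_enum_cond /= -(eqP Ar) -sum1_card.
by rewrite leq_eqVlt; apply/orP; left; apply/eqP; apply: eq_bigl => i.
Qed.

(** There are at least [(t * k) ^ h / h`!] sequences of [h = t + r] classes with
sum at most [t * k], and ['C(h, r)] ways to place [r] red labels.  The factor
[k ^ h] is exactly what the [h] generations lose. *)
Lemma light_types_ge (t r k m0 : nat) :
  (m0 * (t`! * r`!) <= t ^ (t + r))%N ->
  (m0 * k ^ (t + r) <= #|light_types (t * k) (t + r) r|)%N.
Proof.
move=> le; apply: leq_trans (card_light_types _ _ _).
rewrite -(@leq_pmul2r (t`! * r`!)) ?muln_gt0 ?fact_gt0//.
have -> : ('C(t + r + t * k, t + r) * 'C(t + r, r) * (t`! * r`!) =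
    (t + r + t * k) ^_ (t + r))%N.
  rewrite -bin_ffact -mulnA; congr (_ * _)%N.
  rewrite -[in RHS](@bin_fact (t + r) r) ?leq_addl// addnK.
  by rewrite [(r`! * _)%N]mulnC.
apply: leq_trans (_ : (t * k) ^ (t + r) <= _)%N.
  by rewrite expnMn mulnAC leq_mul.
rewrite ffact_prod -[X in (_ ^ X <= _)%N]card_ord -prod_nat_const.
apply: leq_prod => i _; rewrite leq_subRL.
  by rewrite leq_add2r ltnW.
by apply: leq_trans (leq_addr _ _); rewrite ltnW.
Qed.

End Counting.

Section Growth.
Local Open Scope set_scope.
Local Open Scope ring_scope.
Variable R : realType.

Lemma ln_fact_le (n : nat) : (0 < n)%N ->
  ln (n`!%:R : R) <= n%:R * ln (n%:R : R) - n%:R + 1 + ln (n%:R : R).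
Proof.
elim: n => // -[|n] IH _; first by rewrite !ln1 mulr0 sub0r addNr addr0.
have {}IH := IH isT.
rewrite factS natrM lnM ?posrE ?ltr0n ?fact_gt0//.
set m := n.+1 in IH *; have m0 : 0 < m%:R :> R by rewrite ltr0n.
have m10 : 0 < m.+1%:R :> R by rewrite ltr0n.
have key : 1 <= m.+1%:R * (ln (m.+1%:R : R) - ln (m%:R : R)).
  have : ln (1 + (- (m.+1%:R)^-1)) <= - (m.+1%:R)^-1 :> R.
    by apply: le_ln1Dx; rewrite ltrN2 invf_lt1// ltr1n.
  have -> : 1 + - (m.+1%:R)^-1 = m%:R / m.+1%:R :> R.
    by rewrite -natr1; field; rewrite natr1 pnatr_eq0.
  rewrite ln_div ?posrE// => h.
  have h2 : (m.+1%:R)^-1 <= ln (m.+1%:R : R) - ln (m%:R : R).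
    by rewrite -lerN2 opprB.
  by rewrite mulrC -ler_pdivrMr// div1r.
have := natr1 m (R := R) => mE; move: key IH; rewrite -mE; lra.
Qed.

(** The left-hand side of the rate equation increases with [lambda]; it equals
[2 * alpha - 1 < 0] at [2 * alpha] and is positive at [2]. *)
Lemma rate_lambda (alpha : R) : 0 < alpha -> alpha < 2^-1 ->
  exists lambda, [/\ 2 * alpha < lambda, rate_equation alpha lambda &
    forall l, 0 < l -> rate_equation alpha l -> l = lambda].
Proof.
move=> a0 a2; pose F (l : R) := l / 2 + alpha * ln (l / (2 * alpha)) + alpha - 1.
have F_mono l l' : 0 < l -> l < l' -> F l < F l'.
  move=> l0 ll; rewrite /F; have l'0 := lt_trans l0 ll.
  have : ln (l / (2 * alpha)) < ln (l' / (2 * alpha)).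
    by rewrite ltr_ln ?posrE ?divr_gt0 ?mulr_gt0// ltr_pM2r// invr_gt0 mulr_gt0.
  by move=> h; have := ltr_pM2l a0 (ln (l / (2 * alpha))) (ln (l' / (2 * alpha))); rewrite h; lra.
have Fa : F (2 * alpha) < 0.
  rewrite /F divff ?ln1; last by rewrite mulf_neq0// lt0r_neq0.
  lra.
have F2 : 0 < F 2.
  rewrite /F; have : 0 < ln (2 / (2 * alpha) : R).
    by apply: ln_gt0; rewrite ltr_pdivlMr ?mulr_gt0//; lra.
  by move=> h; have := mulr_gt0 a0 h; lra.
have cF : {within `[2 * alpha, 2], continuous F}%classic.
  apply: continuous_in_subspaceT => l; rewrite inE/= in_itv/= => /andP[l1 _].
  have l0 : 0 < l / (2 * alpha).
    by rewrite divr_gt0 ?mulr_gt0//; apply: lt_le_trans l1; rewrite mulr_gt0.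
  have cd : ((fun z : R => z / (2 * alpha)) z @[z --> l] --> l / (2 * alpha))%classic.
    by apply: cvgM; [exact: cvg_id|exact: cvg_cst].
  have cl : (ln (z / (2 * alpha)) @[z --> l] --> ln (l / (2 * alpha)))%classic.
    exact: (cvg_comp _ _ cd (continuous_ln l0)).
  suff : (F z @[z --> l] --> F l)%classic by [].
  rewrite /F; apply: cvgB; last exact: cvg_cst.
  apply: cvgD; last exact: cvg_cst.
  apply: cvgD; first by apply: cvgM; [exact: cvg_id|exact: cvg_cst].
  by apply: cvgM; [exact: cvg_cst|exact: cl].
have [||l lI Fl] := @IVT R F (2 * alpha) 2 0 _ cF; first lra.
  have le : F (2 * alpha) <= F 2 by apply: ltW; apply: lt_trans Fa F2.
  by rewrite (min_idPl le) (max_idPr le) !ltW.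
move: lI; rewrite in_itv/= => /andP[l1 l2].
have al : 2 * alpha < l.
  by rewrite lt_neqAle l1 andbT; apply: contraTneq Fa => ->; rewrite Fl ltxx.
exists l; split=> // l' l'0 Fl'; have l0 : 0 < l by lra.
case: (ltgtP l' l) => // [/(F_mono _ _ l'0)|/(F_mono _ _ l0)].
  by rewrite Fl [F l']Fl' ltxx.
by rewrite Fl [F l']Fl' ltxx.
Qed.

(** Taking [r] close to [theta * t], Stirling's formula gives
[t ^ (t + r) / (t`! * r`!)] the exponential rate [1 + theta * (1 - ln theta)]
in [t]. *)
Lemma block_parameters (theta c : R) : 0 < theta -> theta < 1 ->
    c < 1 + theta * (1 - ln theta) -> 0 < c ->
  exists t r m0 : nat, [/\ (0 < t)%N, (1 < m0)%N, r%:R <= theta * t%:R,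
    (m0 * (t`! * r`!) <= t ^ (t + r))%N & c * t%:R < ln (m0%:R : R)].
Proof.
move=> th0 th1 cth c0.
set gam := 1 + theta * (1 - ln theta) - c.
have gam0 : 0 < gam by rewrite subr_gt0.
have lth : ln theta < 0 by apply: ln_lt0; rewrite th0.
set D := (1 - ln theta) + 2 + ln 2.
have D0 : 0 < D.
  have : 0 < ln (2 : R) by apply: ln_gt0; lra.
  by rewrite /D; lra.
pose m := (Num.truncn ((D + 4) / gam + theta^-1)).+1.
have mgt : (D + 4) / gam + theta^-1 < m%:R.
  by rewrite -truncn_le_nat.
have m1 : 1 <= m%:R :> R by rewrite ler1n.
have mtn : 0 < m%:R :> R by rewrite ltr0n.
have i0 : 0 < theta^-1 by rewrite invr_gt0.
have d0 : 0 < (D + 4) / gam by rewrite divr_gt0//; lra.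
have mD : D + 4 < gam * m%:R.
  by rewrite mulrC -ltr_pdivrMr//; lra.
have mth : 1 < theta * m%:R.
  by rewrite mulrC -ltr_pdivrMr// div1r; lra.
(* With a square [t] the logarithmic terms of Stirling's formula are at most
   linear in [m], hence negligible against [t]. *)
pose t := (m ^ 2)%N.
have tE : t%:R = m%:R * m%:R :> R by rewrite /t natrX expr2.
have t0 : (0 < t)%N by rewrite /t expn_gt0.
clearbody t; clear mgt; clearbody m.
have tR0 : 0 < t%:R :> R by rewrite ltr0n.
pose r := Num.truncn (theta * t%:R).
have tht : 1 < theta * t%:R.
  by rewrite tE mulrA; apply: lt_le_trans mth _; rewrite ler_peMr// mulr_ge0// ltW.
have r0 : (0 < r)%N by rewrite truncn_gt0 ltW.
have rle : r%:R <= theta * t%:R.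
  by rewrite -truncn_ge_nat// mulr_ge0// ltW.
have rge : theta * t%:R - 1 < r%:R.
  by rewrite ltrBlDr natr1 -truncn_le_nat.
clearbody r.
have rR0 : 0 < r%:R :> R by rewrite ltr0n.
pose A := (t ^ (t + r))%N%:R / (t`! * r`!)%N%:R : R.
have fct0 : 0 < (t`! * r`!)%N%:R :> R by rewrite ltr0n muln_gt0 !fact_gt0.
have pw0 : 0 < (t ^ (t + r))%N%:R :> R by rewrite ltr0n expn_gt0 t0.
have A0 : 0 < A by rewrite divr_gt0.
have lnA : c * t%:R + ln 2 < ln A.
  rewrite /A ln_div ?posrE// natrM lnM ?posrE ?ltr0n ?fact_gt0//.
  rewrite natrX lnXn// -[_ *+ (t + r)]mulr_natl natrD.
  have f1 := ln_fact_le t0; have f2 := ln_fact_le r0.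
  have lnr : ln (r%:R : R) <= ln theta + ln (t%:R : R).
    by rewrite -lnM ?posrE// ler_ln ?posrE// mulr_gt0.
  have lnt : ln (t%:R : R) <= 2 * m%:R.
    rewrite tE lnM ?posrE//.
    have : ln (m%:R : R) < m%:R by exact: ln_sublinear.
    lra.
  have p1 : r%:R * ln (r%:R : R) <= r%:R * (ln theta + ln (t%:R : R)).
    by rewrite ler_wpM2l// ltW.
  have p2 : (theta * t%:R - 1) * (1 - ln theta) <= r%:R * (1 - ln theta).
    by rewrite ler_wpM2r//; lra.
  have p3 : (D + 4) * m%:R <= gam * t%:R.
    by rewrite tE mulrA ler_wpM2r// ltW.
  have p4 : D + 4 * m%:R <= (D + 4) * m%:R.
    by have := ler_peMr (ltW D0) m1; lra.
  move: p3 p4; rewrite /gam /D; move: p1 p2 f1 f2 lnt lnr lth.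
  lra.
pose m0 := ((t ^ (t + r)) %/ (t`! * r`!))%N.
have m0gt : A - 1 < m0%:R.
  rewrite ltrBlDr natr1 /A ltr_pdivrMr// -natrM ltr_nat.
  by rewrite ltn_ceil// muln_gt0 !fact_gt0.
have ct0 : 0 < c * t%:R by rewrite mulr_gt0.
have Age : 2 * expR (c * t%:R) < A.
  rewrite -(@ltr_ln R) ?posrE ?mulr_gt0 ?expR_gt0// lnM ?posrE ?expR_gt0//.
  by rewrite expRK; lra.
have e1 : 1 < expR (c * t%:R) by rewrite expR_gt1.
have m0e : expR (c * t%:R) < m0%:R by lra.
exists t, r, m0; split=> //.
- by rewrite -(ltr_nat R); apply: lt_trans m0e.
- by rewrite leq_divM.
- by rewrite -(@ltr_expR R) lnK// posrE; apply: lt_trans m0e; exact: expR_gt0.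
Qed.

End Growth.

(** * Discretised exponential costs *)

Section CostClass.
Local Open Scope classical_set_scope.
Local Open Scope ring_scope.
Variables (R : realType) (K : nat) (a : R).
Hypothesis a_gt0 : 0 < a.

(** Counting the thresholds [j * a], [1 <= j <= K], that are strictly exceeded
makes the events [c <= cost_class x] upper tails, whatever the sign of [x]. *)
Definition cost_class (x : R) : nat := \sum_(j < K) (j.+1%:R * a < x)%R.

Lemma cost_class_ge x c : (c <= K)%N ->
  (c <= cost_class x)%N = (c == 0%N) || (c%:R * a < x).
Proof.
rewrite /cost_class; elim: K c => [|k IH] c ck.
  by move: ck; rewrite leqn0 => /eqP ->.
rewrite big_ord_recr /=; have [lt|ge] := ltP (k.+1%:R * a) x.
  have -> : (\sum_(i < k) (i.+1%:R * a < x)%R = k)%N.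
    rewrite -[RHS](card_ord k) -sum1_card; apply: eq_bigr => i _.
    suff -> : i.+1%:R * a < x by [].
    apply: le_lt_trans lt; rewrite ler_wpM2r ?(ltW a_gt0)// ler_nat ltnS.
    exact: ltnW.
  rewrite addn1 ck; case: eqVneq => //= c0; apply/esym.
  by apply: le_lt_trans lt; rewrite ler_wpM2r ?(ltW a_gt0)// ler_nat.
rewrite addn0; move: ck; rewrite leq_eqVlt => /orP[/eqP ->|/IH//].
rewrite [RHS]/= ltNge ge /=; apply/negbTE; rewrite -ltnNge ltnS.
rewrite -[X in (_ <= X)%N]card_ord -sum1_card; apply: leq_sum => i _.
exact: leq_b1.
Qed.

Lemma cost_class_gt x c : (c < K)%N ->
  (c < cost_class x)%N = (c.+1%:R * a < x).
Proof. by move=> cK; rewrite cost_class_ge. Qed.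

Lemma cost_class_le x : (cost_class x <= K)%N.
Proof.
rewrite -[X in (_ <= X)%N]card_ord -sum1_card; apply: leq_sum => i _.
exact: leq_b1.
Qed.

Lemma cost_class_ub x : (cost_class x < K)%N -> x <= (cost_class x).+1%:R * a.
Proof.
move=> lt; rewrite leNgt; apply/negP => xc.
by have := cost_class_ge x lt; rewrite xc orbT ltnn.
Qed.

Lemma cost_class_lb x : 0 <= x -> (cost_class x)%:R * a <= x.
Proof.
move=> x0; have := cost_class_ge x (cost_class_le x); rewrite leqnn.
by move=> /esym/orP[/eqP ->|/ltW//]; rewrite mul0r.
Qed.

(** The class [K] collects all costs above [K * a]. *)
Definition class_mass (c : nat) : R :=
  expR (- (c%:R * a)) - (if (c < K)%N then expR (- (c.+1%:R * a)) else 0).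

End CostClass.

Section ExponentialLaw.
Local Open Scope classical_set_scope.
Local Open Scope ring_scope.
Variables (R : realType) (d : measure_display) (T : measurableType d).
Variables (P : probability T R) (X : {RV P >-> R}).
Hypothesis X_law : forall A : set R, measurable A ->
  P (X @^-1` A) = exponential_prob 1 A.

Let mX (A : set R) : measurable A -> measurable (X @^-1` A).
Proof. by move=> mA; rewrite -[_ @^-1` _]setTI; exact: measurable_funPT. Qed.

Lemma exponential_neg : P (X @^-1` `]-oo, 0[) = 0%E.
Proof.
rewrite X_law// /exponential_prob integral0_eq// => x /=; rewrite in_itv /= => x0.
by rewrite lt0_exponential_pdf.
Qed.

Lemma exponential_tail (x : R) : 0 <= x ->
  P (X @^-1` `]x, +oo[) = (expR (- x))%:E.
Proof.
move=> x0; have mle : measurable (X @^-1` `]-oo, x]) by exact: (mX (measurable_itv _)).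
rewrite -setCitvl preimage_setC probability_setC; last exact: mle.
have -> : P (X @^-1` `]-oo, x]) = (1 - expR (- x))%:E.
  have -> : X @^-1` `]-oo, x] = X @^-1` `]-oo, 0[ `|` X @^-1` `[0, x].
    rewrite -preimage_setU; congr (_ @^-1` _); apply/seteqP; split => y /=;
    rewrite !in_itv/=.
      by have [y0|y0] := ltP y 0; [left|right].
    by move=> [/ltW/le_trans->//|/andP[_ ->]].
  have -> : P (X @^-1` `]-oo, 0[ `|` X @^-1` `[0, x]) =
      (P (X @^-1` `]-oo, 0%R[) + P (X @^-1` `[0%R, x]))%E.
    apply: measureU.
    - exact: (mX (measurable_itv _)).
    - exact: (mX (measurable_itv _)).
    - apply/seteqP; split=> // y [] /=; rewrite !in_itv/= => y0 /andP[].
      by rewrite leNgt y0.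
  rewrite exponential_neg add0e X_law//; move: x0; rewrite le_eqVlt => /predU1P[<-|x0].
    by rewrite set_itv1 /exponential_prob integral_set1 oppr0 expR0 subrr.
  by rewrite exponential_prob_itv0c// mulN1r EFinB.
by rewrite -EFinB opprB addrC subrK.
Qed.

Lemma class_law (K : nat) (a : R) (c : nat) : 0 < a -> (c <= K)%N ->
  P (X @^-1` [set x | cost_class K a x = c]) = (class_mass K a c)%:E.
Proof.
move=> a0 cK.
have mG j : measurable [set x : R | (j == 0%N) || (j%:R * a < x)].
  case: eqVneq => j0 /=; first by rewrite (_ : [set _ | _] = setT)//; apply/seteqP.
  rewrite (_ : [set _ | _] = `]j%:R * a, +oo[%classic)//; apply/seteqP; split=> x /=;
  by rewrite in_itv/= andbT.
have PG j : P (X @^-1` [set x : R | (j == 0%N) || (j%:R * a < x)]) =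
    (expR (- (j%:R * a)))%:E.
  case: eqVneq => j0 /=.
    rewrite j0 mul0r oppr0 expR0 -(@probability_setT _ _ _ P); congr (P _).
    by apply/seteqP.
  rewrite -exponential_tail; last by rewrite mulr_ge0// ltW.
  by congr (P (_ @^-1` _)); apply/seteqP; split=> x /=; rewrite in_itv/= andbT.
rewrite /class_mass; case: ltnP => [cK'|Kc]; last first.
  rewrite subr0 -PG; congr (P (_ @^-1` _)); apply/seteqP; split=> x /=.
    by rewrite -(cost_class_ge a0 _ cK) => ->.
  rewrite -(cost_class_ge a0 _ cK) => cx; apply/eqP; rewrite eqn_leq cx andbT.
  by apply: leq_trans Kc; exact: cost_class_le.
have -> : [set x | cost_class K a x = c] =
    [set x : R | (c == 0%N) || (c%:R * a < x)] `\`
    [set x : R | (c.+1 == 0%N) || (c.+1%:R * a < x)].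
  apply/seteqP; split=> x /=.
    rewrite -(cost_class_ge a0 _ cK) -(cost_class_gt a0 _ cK').
    by move=> ->; rewrite ltnn leqnn.
  move=> []; rewrite -(cost_class_ge a0 x cK) -(cost_class_gt a0 x cK').
  by move=> cx; move/negP; rewrite -leqNgt => xc; apply/eqP; rewrite eqn_leq xc.
pose G j := [set x : R | (j == 0%N) || (j%:R * a < x)].
rewrite -/(G c) -/(G c.+1).
have -> : P (X @^-1` (G c `\` G c.+1)) =
    (P (X @^-1` G c) - P (X @^-1` G c `&` X @^-1` G c.+1))%E.
  apply: measureD; [exact: (mX (mG _))|exact: (mX (mG _))|].
  by have := PG c; rewrite -/(G c) /= => ->; rewrite ltry.
rewrite setIidr; first by rewrite !PG EFinB.
move=> w; rewrite /G /=; rewrite -(cost_class_gt a0 _ cK') -(cost_class_ge a0 _ cK).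
exact: ltnW.
Qed.

End ExponentialLaw.

Section Labels.
Local Open Scope classical_set_scope.
Local Open Scope ring_scope.
Variables (R : realType) (d : measure_display) (T : measurableType d).
Variables (P : probability T R) (E : finType) (D : {set E}).
Variables (X : E -> {RV P >-> R}) (red : E -> {RV P >-> bool}).
Hypothesis costs : coloured_costs D X red.
Variables (K : nat) (a : R).
Hypothesis a_gt0 : 0 < a.
Local Notation L := ('I_K.+1 * bool)%type.

(** Non-edges get a constant label, since nothing is known of [X] and [red] there. *)
Definition labels (w : T) : {ffun E -> L} :=
  [ffun e => if e \in D then (inord (cost_class K a (X e w)), (red e w : bool))
             else (ord0, false)].

Definition label_mass (e : E) (l : L) : R :=
  if e \in D then class_mass K a l.1 / 2 else (l == (ord0, false))%:R.

Lemma class_mass_ge0 c : 0 <= class_mass K a c.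
Proof.
rewrite /class_mass; case: ifP => _; last by rewrite subr0 expR_ge0.
by rewrite subr_ge0 ler_expR lerN2 ler_wpM2r ?(ltW a_gt0)// ler_nat.
Qed.

Lemma label_mass_ge0 e l : 0 <= label_mass e l.
Proof.
by rewrite /label_mass; case: ifP => _; rewrite ?ler0n// divr_ge0// class_mass_ge0.
Qed.

Lemma sum_class_mass_from c0 : (c0 <= K)%N ->
  \sum_(c < K.+1 | (c0 <= c)%N) class_mass K a c = expR (- (c0%:R * a)).
Proof.
move=> cK; rewrite -(big_mkord (fun c => c0 <= c)%N (class_mass K a)).
rewrite (big_cat_nat _ (n := c0))//=; last exact: leqW.
rewrite big_nat_cond big1 ?add0r; last first.
  by move=> i /andP[/andP[_ lt] ge]; rewrite ltnNge ge in lt.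
rewrite big_nat_cond (eq_bigl (fun i => (c0 <= i < K.+1)%N && true)); last first.
  by move=> i; rewrite andbT -andbA andbC -andbA andbb andbC.
rewrite -big_nat_cond big_nat_recr//= {2}/class_mass ltnn subr0.
rewrite (eq_big_nat _ _ (F2 := fun i : nat => - expR (- (i.+1%:R * a)) - - expR (- (i%:R * a)))); last first.
  by move=> i /andP[_ iK]; rewrite /class_mass iK opprK addrC.
rewrite (telescope_sumr (fun i => - expR (- (i%:R * a))))// opprK; lra.
Qed.

Lemma sum_label (e : E) (S : {set 'I_K.+1}) : e \in D ->
  \sum_(l | l.1 \in S) label_mass e l = \sum_(c in S) class_mass K a c.
Proof.
move=> eD; rewrite /label_mass eD.
rewrite (eq_bigl (fun l : L => (l.1 \in S) && true)); last first.
  by move=> l; rewrite andbT.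
rewrite -(pair_big_dep (fun c => c \in S) (fun _ _ => true)
  (fun c (_ : bool) => class_mass K a c / 2)) /=.
by apply: eq_bigr => c _; rewrite big_bool /= -splitr.
Qed.

Lemma sum_label_mass e : \sum_l label_mass e l = 1.
Proof.
have [eD|eD] := boolP (e \in D); last first.
  rewrite /label_mass (negbTE eD) (bigD1 (ord0, false))// eqxx.
  by rewrite big1 => [|l /negbTE ->]; rewrite /= ?addr0.
rewrite (eq_bigl (fun l : L => l.1 \in [set: 'I_K.+1]%SET)); last first.
  by move=> l; rewrite finset.in_setT.
rewrite sum_label// (eq_bigl (fun c : 'I_K.+1 => (0 <= c)%N)); last first.
  by move=> c; rewrite finset.in_setT.
by rewrite sum_class_mass_from// mul0r oppr0 expR0.
Qed.

Let cellX (c : nat) : set R := [set x | cost_class K a x = c].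

Lemma measurable_cost_class c : measurable (cellX c).
Proof.
pose G j := [set x : R | (j <= cost_class K a x)%N].
have mG j : measurable (G j).
  have [jK|jK] := leqP j K.
    rewrite /G; under eq_set do rewrite (cost_class_ge a_gt0 _ jK).
    case: eqVneq => j0 /=; first by rewrite (_ : [set _ | _] = setT)//; apply/seteqP.
    rewrite (_ : [set _ | _] = `]j%:R * a, +oo[%classic)//; apply/seteqP; split=> x /=;
    by rewrite in_itv/= andbT.
  rewrite (_ : G j = set0)//; apply/seteqP; split=> // x; rewrite /G /=.
  by rewrite leqNgt (leq_ltn_trans (cost_class_le _ _ _) jK).
rewrite (_ : cellX c = G c `\` G c.+1); first exact: measurableD.
apply/seteqP; split=> x; rewrite /cellX /G /=.
  by move=> ->; split=> //; rewrite ltnn.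
move=> [le]; by move/negP; rewrite -leqNgt => ge; apply/eqP; rewrite eqn_leq ge.
Qed.

Lemma colour_mass e b : e \in D -> P (red e @^-1` [set b]) = (2^-1)%:E.
Proof.
move=> eD; have ctrue : P (red e @^-1` [set true]) = (2^-1)%:E.
  exact: (colour_law costs eD).
case: b => //.
have -> : red e @^-1` [set false] = ~` (red e @^-1` [set true]).
  by apply/seteqP; split=> w /=; case: (red e w).
rewrite probability_setC; last first.
  by rewrite -[_ @^-1` _]setTI; exact: measurable_funPT.
by rewrite [X in (_ - X)%E]ctrue -EFinB; congr EFin; lra.
Qed.

Let fibre (f : {ffun E -> L}) (s : E + E) : set T :=
  match s with
  | inl e => X e @^-1` cellX (f e).1
  | inr e => red e @^-1` [set (f e).2]
  end.

Lemma labels_fibre (f : {ffun E -> L}) :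
    (forall e, e \notin D -> f e = (ord0, false)) ->
  [set w | labels w = f] =
  \bigcap_(s in [set` [set s : E + E | match s with inl e => e \in D
                                                  | inr e => e \in D end]%SET])
    fibre f s.
Proof.
move=> fD; apply/seteqP; split=> w /=.
  move=> <- [] e /=; rewrite !inE ffunE => ->; rewrite /cellX//=.
  by rewrite inordK// ltnS cost_class_le.
move=> H; apply/ffunP => e; rewrite ffunE; case: ifPn => eD; last by rewrite fD.
have /= := H (inl e); rewrite inE => /(_ eD); rewrite /cellX /= => ->.
have /= := H (inr e); rewrite inE => /(_ eD) ->.
by rewrite inord_val -surjective_pairing.
Qed.

Lemma labels_empty (f : {ffun E -> L}) e : e \notin D -> f e != (ord0, false) ->
  [set w | labels w = f] = set0.
Proof.
move=> eD fe; apply/seteqP; split=> // w /= lf.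
by move: fe; rewrite -lf ffunE (negbTE eD) eqxx.
Qed.

Lemma measurable_labels1 (f : {ffun E -> L}) : measurable [set w | labels w = f].
Proof.
have [fD|] := pselect (forall e, e \notin D -> f e = (ord0, false)).
  rewrite labels_fibre//; apply: fin_bigcap_measurable => // -[e|e] _ /=.
    have mc := measurable_cost_class (f e).1.
    by rewrite -[_ @^-1` _]setTI; exact: measurable_funPT.
  by rewrite -[_ @^-1` _]setTI; exact: measurable_funPT.
move=> /existsNP[e /not_implyP[eD /eqP fe]].
by rewrite (labels_empty eD fe).
Qed.

Lemma labels_law1 (f : {ffun E -> L}) :
  P [set w | labels w = f] = (mass label_mass f)%:E.
Proof.
have [fD|] := pselect (forall e, e \notin D -> f e = (ord0, false)); last first.
  move=> /existsNP[e /not_implyP[eD /eqP fe]].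
  rewrite (labels_empty eD fe) measure0 /mass (bigD1 e)//= /label_mass.
  by rewrite (negbTE eD) (negbTE fe) mul0r.
rewrite labels_fibre// (costs_colours_independent costs); last 2 first.
- by [].
- case=> e; rewrite inE => eD /=.
    exists (cellX (f e).1); first exact: measurable_cost_class.
    by rewrite setTI.
  by exists [set (f e).2] => //; rewrite setTI.
rewrite big_sumType /=.
rewrite (eq_bigl (fun e => e \in D)); last by move=> e; rewrite inE.
rewrite [X in (_ * X)%E](eq_bigl (fun e => e \in D)); last by move=> e; rewrite inE.
rewrite (eq_bigr (fun e => (class_mass K a (f e).1)%:E)); last first.
  move=> e eD; apply: (class_law (X := X e)) => //; last by rewrite -ltnS.
  by move=> A mA; exact: (cost_law costs eD).
rewrite [X in (_ * X)%E](eq_bigr (fun e => (2^-1)%:E)); last first.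
  by move=> e eD; exact: colour_mass.
rewrite !prodEFin -EFinM -big_split /=; congr EFin.
rewrite /mass big_mkcond; apply: eq_bigr => e _; rewrite /label_mass.
by case: ifPn => // eD; rewrite fD// eqxx.
Qed.

(** Labels of distinct edges are independent, so the law of the whole labelling is
a product and any event on labels is a finite disjoint union of its atoms. *)
Lemma labels_law (Ev : {set {ffun E -> L}}) :
  measurable [set w | labels w \in Ev] /\
  P [set w | labels w \in Ev] = (Pr label_mass Ev)%:E.
Proof.
have -> : [set w | labels w \in Ev] =
    \bigcup_(f in [set` Ev]) [set w | labels w = f].
  apply/seteqP; split=> w /=; first by move=> h; exists (labels w).
  by move=> [f fE /= ->].
split.
  by apply: fin_bigcup_measurable => // f _; exact: measurable_labels1.
have -> : P (\bigcup_(f in [set` Ev]) [set w | labels w = f]) =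
   (\sum_(f \in [set` Ev]) P [set w | labels w = f])%E.
  apply: measure_fin_bigcup => //; last by move=> f _; exact: measurable_labels1.
  by move=> f g _ _ [w [/= <- <-]].
rewrite (_ : [set` Ev] = [set` enum Ev]); last first.
  by apply/seteqP; split=> f /=; rewrite mem_enum.
rewrite -fsbig_seq ?enum_uniq// big_enum /= /Pr -sumEFin.
by apply: eq_bigr => f _; exact: labels_law1.
Qed.

End Labels.

(** * First moment of the number of cheap paths *)

Section PathEdges.
Local Open Scope set_scope.
Local Open Scope ring_scope.
Import fintype boot.finset.
Variables (V E : finType) (edge : V -> V -> E).
Hypothesis edge_inj : edge_injective edge.

Lemma pairmap_edgeP (x : V) (p : seq V) (e : E) : uniq (x :: p) ->
  e \in pairmap edge x p ->
  exists i j, [/\ i \in x :: p, j \in x :: p, i != j & e = edge i j].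
Proof.
elim: p x => //= z p IH x; rewrite !inE negb_or => /andP[/andP[xz xp] up].
case/orP => [/eqP ->|ep].
  by exists x, z; rewrite xz !inE !eqxx orbT.
have [i [j [ip jp ij ->]]] := IH z up ep; exists i, j; split=> //.
  by rewrite inE ip orbT.
by rewrite inE jp orbT.
Qed.

Lemma uniq_path_edges (x : V) (p : seq V) : uniq (x :: p) -> uniq (pairmap edge x p).
Proof.
elim: p x => //= z p IH x /andP[xp up]; rewrite IH// andbT.
apply/negP => /(pairmap_edgeP up)[i [j [ip jp _ /edge_inj]]].
by case=> -[e _]; [rewrite e ip in xp|rewrite e jp in xp].
Qed.

End PathEdges.

Section FirstMoment.
Local Open Scope set_scope.
Local Open Scope ring_scope.
Import fintype boot.finset.
Variables (R : realType) (V E : finType) (edge : V -> V -> E) (D : {set E}).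
Hypothesis edge_inj : edge_injective edge.
Hypothesis edge_in : forall i j, i != j -> edge i j \in D.
Variables (K : nat) (eta theta sigma : R).
Hypothesis eta_gt0 : 0 < eta.
Hypothesis theta_gt0 : 0 < theta.
Hypothesis sigma_ge0 : 0 <= sigma.
Hypothesis V_gt0 : (0 < #|V|)%N.
Local Notation L := ('I_K.+1 * bool)%type.
Local Notation N := (#|V|%:R : R).
Let a : R := eta / N.
Let w := @label_mass R E D K a.

Let N_gt0 : 0 < N. Proof. by rewrite ltr0n. Qed.
Let a_gt0 : 0 < a. Proof. by rewrite divr_gt0. Qed.
Let w_ge0 := @label_mass_ge0 R E D K a a_gt0.
Let w_sum1 := @sum_label_mass R E D K a.

(** The exponential weight whose product over the edges of a path dominates, up to
a constant factor, the indicator that the path is cheap. *)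
Definition tilt (l : L) : R :=
  if (l.1 < K)%N then expR (- (theta * eta * l.1%:R) - sigma * l.2%:R) else 0.

(** [#|V|] times a bound on the mean of [tilt], the sum of a geometric series over
the classes. *)
Definition tilted_mass : R :=
  eta * ((1 + expR (- sigma)) / 2) / (1 - expR (- (theta * eta))).

Let te_gt0 : 0 < theta * eta. Proof. by rewrite mulr_gt0. Qed.

Let q1 : 0 < 1 - expR (- (theta * eta)).
Proof. by rewrite subr_gt0 -expR0 ltr_expR oppr_lt0. Qed.

Let tilt_ge0 l : 0 <= tilt l.
Proof. by rewrite /tilt; case: ifP; rewrite ?expR_ge0. Qed.

Lemma tilted_mass_ge0 : 0 <= tilted_mass.
Proof.
by rewrite /tilted_mass divr_ge0 ?(ltW q1)// mulr_ge0 ?(ltW eta_gt0)// divr_ge0// addr_ge0// expR_ge0.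
Qed.

Lemma sum_tilt_le e : e \in D -> \sum_l w e l * tilt l <= tilted_mass / N.
Proof.
move=> eD; rewrite /w /label_mass eD.
rewrite -(pair_bigA _ (fun (c : 'I_K.+1) (b : bool) =>
   class_mass K a c / 2 * tilt (c, b))) /=.
rewrite big_ord_recr /= big_bool /tilt /= ltnn !mulr0 !addr0.
set q := expR (- (theta * eta)).
apply: le_trans (_ : \sum_(c < K) a * ((1 + expR (- sigma)) / 2) * q ^+ c <= _).
  apply: ler_sum => c _; rewrite big_bool /= ltn_ord !mulr1 !mulr0 subr0.
  have -> : expR (- (theta * eta * c%:R)) = q ^+ c.
    by rewrite /q -expRM_natl; congr expR; ring.
  have -> : expR (- (theta * eta * c%:R) - sigma) = q ^+ c * expR (- sigma).
    by rewrite /q -expRM_natl -expRD; congr expR; ring.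
  have ca : class_mass K a c <= a.
    rewrite /class_mass ltn_ord.
    have -> : expR (- (c.+1%:R * a)) = expR (- (c%:R * a)) * expR (- a).
      by rewrite -expRD; congr expR; rewrite -natr1; lra.
    have h1 : expR (- (c%:R * a)) <= 1.
      by rewrite -expR0 ler_expR oppr_le0 mulr_ge0// ltW.
    have h2 : 1 - a <= expR (- a) by have := expR_ge1Dx (- a); lra.
    have h3 : 0 <= expR (- (c%:R * a)) by exact: expR_ge0.
    have := ler_wpM2l h3 h2; have := ler_wpM2r (ltW a_gt0) h1; lra.
  have p : 0 <= q ^+ c * (1 + expR (- sigma)) / 2.
    by rewrite divr_ge0// mulr_ge0 ?exprn_ge0 ?expR_ge0// addr_ge0// expR_ge0.
  by have := ler_wpM2r p ca; lra.
rewrite -mulr_sumr /tilted_mass.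
have geo : \sum_(c < K) q ^+ c <= (1 - q)^-1.
  rewrite -[leRHS]div1r ler_pdivlMr// mulrC -opprB mulNr.
  by rewrite -subrX1 opprB gerBl exprn_ge0// expR_ge0.
rewrite (_ : eta * _ / _ / N = a * ((1 + expR (- sigma)) / 2) * (1 - q)^-1); last first.
  by rewrite /a -/q; ring.
rewrite ler_wpM2l// mulr_ge0 ?(ltW a_gt0)// divr_ge0// addr_ge0// expR_ge0.
Qed.

Definition cheap_path (Lam kr : R) (x y : V) (p : seq V) (f : {ffun E -> L}) : bool :=
  [&& uniq (x :: p), last x p == y,
      \sum_(e <- pairmap edge x p) eta * (f e).1%:R <= Lam &
      (count (fun e => (f e).2) (pairmap edge x p))%:R <= kr].

(** Markov's inequality for the product of the tilts.  The condition on [Lam]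
forces all classes on a cheap path below [K], where [tilt] does not vanish. *)
Lemma Pr_cheap_path_le (Lam kr : R) (x y : V) (p : seq V) : Lam < eta * K%:R ->
  Pr w [set f : {ffun E -> L} | cheap_path Lam kr x y p f] <=
  expR (theta * Lam + sigma * kr) * (tilted_mass / N) ^+ size p.
Proof.
move=> LK; set s := pairmap edge x p.
have tN : 0 <= tilted_mass / N by rewrite divr_ge0// tilted_mass_ge0.
have [up|up] := boolP (uniq (x :: p)); last first.
  rewrite (_ : [set f | _] = set0); first by
    rewrite /Pr big_set0 mulr_ge0 ?expR_ge0 ?exprn_ge0.
  by apply/setP => f; rewrite !inE /cheap_path (negbTE up).
have us : uniq s by exact: uniq_path_edges.
have sD e : e \in s -> e \in D.
  by case/(pairmap_edgeP up) => i [j [_ _ ij ->]]; exact: edge_in.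
have -> : size p = size s by rewrite size_pairmap.
apply: le_trans (_ : Ex w (fun f => expR (theta * Lam + sigma * kr) *
    \prod_e (if e \in s then tilt (f e) else 1)) <= _).
  rewrite PrE; apply: Ex_le => // f; rewrite inE.
  have pr0 : 0 <= \prod_e (if e \in s then tilt (f e) else 1).
    by apply: prodr_ge0 => e _; case: ifP.
  case: (boolP (cheap_path _ _ _ _ _ _)) => [|_]; last by rewrite mulr_ge0// expR_ge0.
  move=> /and4P[_ _ cost_le red_le].
  rewrite -big_mkcond -big_uniq//=.
  have fK e : e \in s -> ((f e).1 < K)%N.
    move=> es; rewrite -(ltr_nat R) -(ltr_pM2l eta_gt0); apply: le_lt_trans LK.
    apply: le_trans cost_le; rewrite -/s (bigD1_seq e)//= lerDl.
    by apply: sumr_ge0 => *; rewrite mulr_ge0// ltW.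
  rewrite (eq_big_seq (fun e => expR (- (theta * eta * (f e).1%:R) - sigma * (f e).2%:R))); last first.
    by move=> e es; rewrite /tilt fK.
  rewrite -expR_sum -expRD -[leLHS]expR0 ler_expR big_split /= sumrN.
  rewrite sumrN -!mulr_sumr.
  have c1 : \sum_(e <- s) (f e).2%:R = (count (fun e => (f e).2) s)%:R :> R.
    rewrite -sum1_count natr_sum [RHS]big_mkcond; apply: eq_bigr => e _.
    by case: (f e).2.
  have c2 : \sum_(e <- s) eta * (f e).1%:R = eta * \sum_(e <- s) (f e).1%:R.
    by rewrite mulr_sumr.
  rewrite c1; rewrite -/s c2 in cost_le; rewrite -/s in red_le.
  have := ler_wpM2l (ltW theta_gt0) cost_le; have := ler_wpM2l sigma_ge0 red_le.
  by rewrite mulrA; lra.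
rewrite ExZ ler_wpM2l ?expR_ge0//.
rewrite (Ex_prod w (fun e l => if e \in s then tilt l else 1)).
apply: le_trans (_ : \prod_e (if e \in s then tilted_mass / N else 1) <= _).
  apply: ler_prod => e _; case: ifPn => es.
    rewrite sum_tilt_le ?sD// andbT; apply: sumr_ge0 => l _.
    by rewrite mulr_ge0.
  by under eq_bigr do rewrite mulr1; rewrite w_sum1 lexx ler01.
by rewrite -big_mkcond -big_uniq//= big_const_seq count_predT iter_mulr_1.
Qed.

(** Union bound over the lists [t] of inner vertices: a path with [m] inner
vertices has [m.+1] edges, so one factor [#|V|^-1] remains. *)
Lemma Pr_cheap_paths_le (Lam kr : R) (x y : V) : x != y ->
    Lam < eta * K%:R -> tilted_mass < 1 ->
  Pr w [set f : {ffun E -> L} | `[< exists p, cheap_path Lam kr x y p f >] ] <=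
  expR (theta * Lam + sigma * kr) * (1 - tilted_mass)^-1 / N.
Proof.
move=> xy LK t1; have t0 := tilted_mass_ge0.
set c := expR _.
apply: le_trans (_ : Pr w (\bigcup_(m < #|V|) \bigcup_(t : m.-tuple V)
   [set f : {ffun E -> L} | cheap_path Lam kr x y (rcons t y) f]) <= _).
  apply: Pr_subset => //; apply/subsetP => f; rewrite inE => /asboolP[p pf].
  have /and4P[up lp _ _] := pf.
  case/lastP: p up lp pf => [|p z]; first by move=> _ /= e; rewrite e in xy.
  rewrite last_rcons => up /eqP -> pf.
  have sp : (size p < #|V|)%N.
    have := max_card (mem (x :: rcons p z)); rewrite (card_uniqP up) /= size_rcons.
    exact: leq_trans.
  apply/bigcupP; exists (Ordinal sp) => //; apply/bigcupP; exists (in_tuple p) => //.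
  by rewrite inE.
apply: le_trans (Pr_bigcup_le w_ge0 _ _) _.
apply: le_trans (_ : \sum_(m < #|V|) c * tilted_mass ^+ m / N <= _).
  apply: ler_sum => m _; apply: le_trans (Pr_bigcup_le w_ge0 _ _) _.
  apply: le_trans (_ : \sum_(t : m.-tuple V) c * (tilted_mass / N) ^+ m.+1 <= _).
    apply: ler_sum => t _; apply: le_trans (Pr_cheap_path_le _ _ _ _ LK) _.
    by rewrite size_rcons size_tuple.
  rewrite sumr_const card_tuple -[leLHS]mulr_natr natrX.
  rewrite (_ : c * _ * _ = c * tilted_mass ^+ m / N * tilted_mass); last first.
    by rewrite exprS expr_div_n; field; rewrite expf_neq0 ?lt0r_neq0.
  by rewrite ler_piMr ?(ltW t1)// divr_ge0// mulr_ge0 ?exprn_ge0// expR_ge0.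
rewrite -mulr_suml -mulr_sumr ler_wpM2r ?invr_ge0// ler_wpM2l ?expR_ge0//.
have t1' : 0 < 1 - tilted_mass by rewrite subr_gt0.
rewrite -[leRHS]div1r ler_pdivlMr// mulrC -opprB mulNr.
by rewrite -subrX1 opprB gerBl exprn_ge0.
Qed.

End FirstMoment.

(** * Probability of a good path *)

Section LabelSums.
Local Open Scope set_scope.
Local Open Scope ring_scope.
Import fintype boot.finset.
Variables (R : realType) (E : finType) (D : {set E}) (K J : nat) (a : R).
Hypothesis a_gt0 : 0 < a.
Hypothesis J_lt : (J < K)%N.
Local Notation L := ('I_K.+1 * bool)%type.
Variable e : E.
Hypothesis eD : e \in D.
Let w (l : L) : R := label_mass D a e l.

Lemma one_sub_expR_le (x : R) : 1 - expR (- x) <= x.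
Proof. by have := expR_ge1Dx (- x); lra. Qed.

Lemma one_sub_expR_ge (x : R) : 0 <= x -> x * (1 - x) <= 1 - expR (- x).
Proof.
move=> x0; have h1 := expR_ge1Dx (- x); have h2 := expR_ge1Dx x.
have := ler_wpM2r (expR_ge0 (- x)) h2; rewrite -expRD subrr expR0.
have := ler_wpM2l x0 h1; lra.
Qed.

Lemma sum_label_lt (j : nat) : (j <= K)%N ->
  \sum_(l : L | (l.1 < j)%N) w l = 1 - expR (- (j%:R * a)).
Proof.
move=> jK; rewrite -(sum_class_mass_from a jK).
rewrite (eq_bigl (fun l : L => l.1 \in [set c : 'I_K.+1 | (c < j)%N])); last first.
  by move=> l; rewrite inE.
rewrite /w sum_label// (eq_bigl (fun c : 'I_K.+1 => (c < j)%N)); last first.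
  by move=> c; rewrite inE.
have := sum_class_mass_from a (leq0n K); rewrite mul0r oppr0 expR0 => <-.
rewrite [in RHS](bigID (fun c : 'I_K.+1 => (c < j)%N)) /=.
rewrite [X in _ = _ + X - _](eq_bigl (fun c : 'I_K.+1 => (j <= c)%N)); last first.
  by move=> c; rewrite -leqNgt.
by rewrite addrK.
Qed.

Lemma sum_short_label_ge (b : 'I_J.+1 * bool) :
  a * (1 - J.+1%:R * a) / 2 <= \sum_(l | short_label J l == Some b) w l.
Proof.
have bK : (b.1 < K)%N by apply: leq_ltn_trans J_lt; rewrite -ltnS.
have bK1 : (b.1 < K.+1)%N by apply: ltnW.
rewrite (bigD1 (Ordinal bK1, b.2)) /=; last first.
  rewrite /short_label /= -ltnS ltn_ord; apply/eqP; congr Some.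
  by rewrite [RHS]surjective_pairing; congr pair; apply: val_inj; rewrite /= inordK.
apply: le_trans (_ : w (Ordinal bK1, b.2) <= _); last first.
  by rewrite lerDl; apply: sumr_ge0 => l _; exact: label_mass_ge0.
rewrite /w /label_mass eD /= /class_mass bK ler_wpM2r//.
set c : nat := b.1.
have cJ : (c.+1 <= J.+1)%N by exact: ltn_ord.
have -> : expR (- (c%:R * a)) = expR (- (c.+1%:R * a)) * expR a.
  by rewrite -expRD; congr expR; rewrite -natr1; ring.
have h1 := expR_ge1Dx a.
have h2 : 1 - J.+1%:R * a <= expR (- (c.+1%:R * a)).
  have h3 : c.+1%:R * a <= J.+1%:R * a by rewrite ler_wpM2r ?(ltW a_gt0)// ler_nat.
  by have := expR_ge1Dx (- (c.+1%:R * a)); lra.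
have := ler_wpM2l (expR_ge0 (- (c.+1%:R * a))) h1.
have := ler_wpM2l (ltW a_gt0) h2; lra.
Qed.

Lemma sum_short_label_le :
  \sum_(l | short_label J l != None) w l <= J.+1%:R * a.
Proof.
rewrite (eq_bigl (fun l : L => (l.1 < J.+1)%N)); last first.
  by move=> l; rewrite /short_label ltnS; case: ifP.
by rewrite sum_label_lt//; exact: one_sub_expR_le.
Qed.

Lemma sum_cheap_label_ge : K%:R * a * (1 - K%:R * a) <=
  \sum_(l | cheap_label l == Some tt) w l.
Proof.
rewrite (eq_bigl (fun l : L => (l.1 < K)%N)); last first.
  by move=> l; rewrite /cheap_label; case: ifP.
by rewrite sum_label_lt//; apply: one_sub_expR_ge; rewrite mulr_ge0// ltW.
Qed.

Lemma sum_cheap_label_le : \sum_(l | cheap_label l != None) w l <= K%:R * a.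
Proof.
rewrite (eq_bigl (fun l : L => (l.1 < K)%N)); last first.
  by move=> l; rewrite /cheap_label; case: ifP.
by rewrite sum_label_lt//; exact: one_sub_expR_le.
Qed.

End LabelSums.

Section GoodPath.
Local Open Scope set_scope.
Local Open Scope ring_scope.
Import fintype boot.finset.
Variables (R : realType) (V E : finType) (edge : V -> V -> E) (D : {set E}).
Hypothesis edge_inj : edge_injective edge.
Hypothesis edge_in : forall i j, i != j -> edge i j \in D.

(** By the choice of [eta] a vertex has on average [(1 + 3 * delta) / k] neighbours
through each short label.  Three factors [1 - xi] are lost: on the labels of
higher classes, on the vertices already used, and on the vertices hit more than
once.  What remains is at least [(1 + delta) / k], as each generation needs. *)
Lemma Pr_reach_ge (x y : V) (t r m0 k sigma m K : nat) (delta eta xi : R) :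
  let h := (t + r)%N in
  let J := (t * k)%N in
  let Z := (type_bound J k h * (sigma * m0 ^ m))%N in
    x != y -> (0 < k)%N -> (0 < sigma)%N -> (1 < m0)%N ->
    (m0 * (t`! * r`!) <= t ^ (t + r))%N ->
    0 < delta -> eta = 2 * (1 + 3 * delta) / k%:R ->
    0 < xi -> xi <= 2^-1 -> 1 + delta <= (1 + 3 * delta) * (1 - xi) ^+ 3 ->
    (J < K)%N ->
    Z%:R * (K%:R * eta) <= xi * #|V|%:R ->
    ((k ^ h * sigma + m * (h * Z)) * 2 + 2)%N%:R <= xi * #|V|%:R ->
    32 * (k ^ h * sigma)%:R <= K%:R * eta ->
    (#|V| <= (m0 ^ m) ^ 2)%N ->
  1 - (2 / sigma%:R + (h%:R * (2 * step_error J delta h sigma) +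
    2 / (k ^ h * sigma)%:R) * 2)
  <= Pr (@label_mass R E D K (eta / #|V|%:R))
       [set f | `[< reach edge f x [set: V] y
          ((K + m * (J + h)) * 2 + K) ((1 + m * r) * 2 + 1) >] ].
Proof.
move=> h J Z xy k0 s0 m02 m0le d0 etaE xi0 xi2 xid JK ZK FN Kbig mN.
have V0 : (0 < #|V|)%N by apply/card_gt0P; exists x.
set N : R := #|V|%:R; have N0 : 0 < N by rewrite ltr0n.
have kR0 : 0 < k%:R :> R by rewrite ltr0n.
have eta0 : 0 < eta by rewrite etaE divr_gt0// mulr_gt0//; lra.
set a := eta / N; have a0 : 0 < a by rewrite divr_gt0.
pose F0 := (#|V| - ((k ^ h * sigma + m * (h * Z)) * 2 + 2))%N.
have subV : ((k ^ h * sigma + m * (h * Z)) * 2 + 2 <= #|V|)%N.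
  rewrite -(ler_nat R); apply: le_trans FN _; rewrite -/N.
  by rewrite ler_piMl ?(ltW N0)//; lra.
have F0N : (1 - xi) * N <= F0%:R.
  by rewrite /F0 natrB// mulrBl mul1r lerD2l lerN2.
have K0 : (0 < K)%N by apply: leq_ltn_trans JK.
have Z0 : (0 < Z)%N.
  by rewrite /Z /type_bound !muln_gt0 !expn_gt0 k0 card_Om_gt0 s0 (ltnW m02).
have ZKa : Z%:R * (K%:R * a) <= xi.
  by rewrite /a !mulrA ler_pdivrMr// -/N -mulrA.
have Ka : K%:R * a <= xi.
  apply: le_trans ZKa; apply: ler_peMl; first by rewrite mulr_ge0// ltW.
  by rewrite ler1n.
have Ja : J.+1%:R * a <= xi.
  by apply: le_trans Ka; rewrite ler_wpM2r ?(ltW a0)// ler_nat.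
have ZJa : Z%:R * (J.+1%:R * a) <= xi.
  apply: le_trans ZKa; rewrite ler_wpM2l// ler_wpM2r ?(ltW a0)// ler_nat//.
set S := (k ^ h * (sigma * m0 ^ m))%N.
have SZ : (S <= Z)%N.
  rewrite /S /Z /type_bound leq_mul// leq_pmull// expn_gt0.
  by rewrite card_Om_gt0.
have SKa : S%:R * (K%:R * a) <= xi.
  apply: le_trans ZKa; apply: ler_wpM2r; first by rewrite mulr_ge0// ltW.
  by rewrite ler_nat.
have SN : N <= S%:R * S%:R.
  rewrite -natrM ler_nat; apply: leq_trans mN _; rewrite -mulnn leq_mul//;
  by rewrite /S mulnA leq_pmull// muln_gt0 expn_gt0 k0.
have x1 : 0 <= 1 - xi by lra.
have Na : N * a = eta by rewrite /a mulrC divfK// lt0r_neq0.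
have xi4 : 16^-1 <= (1 - xi) ^+ 4.
  have -> : 16^-1 = (1 - 2^-1) ^+ 4 :> R by field.
  by rewrite lerXn2r ?nnegrE//; lra.
have Kd : 0 <= K%:R * a by rewrite mulr_ge0// ltW.
have Jd : 0 <= J.+1%:R * a by rewrite mulr_ge0// ltW.
have Keta : 0 <= K%:R * eta by rewrite mulr_ge0// ltW.
have sk : sigma%:R <= (k ^ h * sigma)%:R :> R.
  by rewrite ler_nat leq_pmull// expn_gt0 k0.
have cert := @certified_connection R V E K J k (@label_mass R E D K a) edge
  (label_mass_ge0 _ a0) (sum_label_mass D K a) edge_inj x y
  (a * (1 - J.+1%:R * a) / 2) (J.+1%:R * a) (K%:R * a * (1 - K%:R * a)) (K%:R * a)
  delta h r m0 sigma F0 Z m xy JK k0 s0 m02 (light_types_ge _ m0le) d0.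
have [|||||||||||||Ev [_ PE EC]] := cert.
- by rewrite divr_ge0// mulr_ge0 ?(ltW a0)//; lra.
- exact: Jd.
- by rewrite mulr_ge0//; lra.
- exact: Kd.
- by move=> i j b ij; apply: sum_short_label_ge => //; exact: edge_in.
- by move=> i j ij; apply: sum_short_label_le => //; exact: edge_in.
- by move=> i j ij; apply: sum_cheap_label_ge => //; exact: edge_in.
- by move=> i j ij; apply: sum_cheap_label_le => //; exact: edge_in.
- apply: le_trans xid _.
  have -> : 1 + 3 * delta = k%:R * eta / 2 by rewrite etaE; field; rewrite lt0r_neq0.
  have -> : k%:R * (a * (1 - J.+1%:R * a) / 2) * F0%:R * (1 - Z%:R * (J.+1%:R * a)) =
    k%:R / 2 * ((a * F0%:R) * ((1 - J.+1%:R * a) * (1 - Z%:R * (J.+1%:R * a)))) by ring.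
  have -> : k%:R * eta / 2 * (1 - xi) ^+ 3 =
    k%:R / 2 * ((eta * (1 - xi)) * ((1 - xi) * (1 - xi))) by ring.
  rewrite ler_wpM2l ?divr_ge0//.
  have aF : eta * (1 - xi) <= a * F0%:R.
    by have := ler_wpM2l (ltW a0) F0N; rewrite mulrCA [a * N]mulrC Na mulrC.
  apply: ler_pM => //; [by rewrite mulr_ge0// ltW|by rewrite mulr_ge0|].
  by apply: ler_pM => //; lra.
- have -> : K%:R * a * (1 - K%:R * a) * F0%:R * (1 - K%:R * a) =
    K%:R * (a * F0%:R) * ((1 - K%:R * a) * (1 - K%:R * a)) by ring.
  have aF : eta * (1 - xi) <= a * F0%:R.
    by have := ler_wpM2l (ltW a0) F0N; rewrite mulrCA [a * N]mulrC Na mulrC.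
  apply: le_trans (_ : K%:R * (eta * (1 - xi)) * ((1 - xi) * (1 - xi)) <= _); last first.
    apply: ler_pM => //.
    + by rewrite mulr_ge0// mulr_ge0// ltW.
    + by rewrite mulr_ge0.
    + by rewrite ler_wpM2l.
    + by apply: ler_pM => //; lra.
  have -> : K%:R * (eta * (1 - xi)) * ((1 - xi) * (1 - xi)) =
    K%:R * eta * (1 - xi) ^+ 3 by ring.
  have x3 : 8^-1 <= (1 - xi) ^+ 3.
    have -> : 8^-1 = (1 - 2^-1) ^+ 3 :> R by field.
    by rewrite lerXn2r ?nnegrE//; lra.
  have := ler_wpM2l Keta x3.
  have : 0 <= (k ^ h * sigma)%:R :> R by [].
  lra.
- rewrite -/S.
  have -> : S%:R * (K%:R * a * (1 - K%:R * a)) * S%:R * (1 - S%:R * (K%:R * a)) =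
    (S%:R * S%:R) * (K%:R * a) * ((1 - K%:R * a) * (1 - S%:R * (K%:R * a))) by ring.
  apply: le_trans (_ : N * (K%:R * a) * ((1 - xi) * (1 - xi)) <= _); last first.
    apply: ler_pM => //.
    + by rewrite mulr_ge0// ltW.
    + by rewrite mulr_ge0.
    + by rewrite ler_wpM2r.
    + by apply: ler_pM => //; lra.
  have -> : N * (K%:R * a) * ((1 - xi) * (1 - xi)) = K%:R * eta * (1 - xi) ^+ 2.
    by rewrite -Na; ring.
  have x22 : 4^-1 <= (1 - xi) ^+ 2.
    have -> : 4^-1 = (1 - 2^-1) ^+ 2 :> R by field.
    by rewrite lerXn2r ?nnegrE//; lra.
  have := ler_wpM2l Keta x22.
  have : 0 <= (k ^ h * sigma)%:R :> R by [].
  lra.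
- exact: leqnn.
- by rewrite /F0 -addnA subnK.
apply: le_trans PE _; apply: Pr_subset; first exact: label_mass_ge0.
by apply/subsetP => f fE; rewrite inE; apply/asboolP; exact: EC.
Qed.

End GoodPath.

(** * The minimum cost as a random variable *)

Section MinCost.
Local Open Scope classical_set_scope.
Local Open Scope ring_scope.
Variables (R : realType) (d : measure_display) (T : measurableType d).
Variables (P : probability T R) (V E : finType) (edge : V -> V -> E) (D : {set E}).
Hypothesis edge_in : forall i j, i != j -> edge i j \in D.
Variables (X : E -> {RV P >-> R}) (red : E -> {RV P >-> bool}).
Hypothesis costs : coloured_costs D X red.
Variables (rho : R) (x y : V).

Definition min_cost_rv (w : T) : \bar R :=
  min_cost edge (fun e => X e w) (fun e => red e w) rho x y.

Lemma min_cost_rv_lt (w : T) (u : \bar R) :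
  (min_cost_rv w < u)%E <->
  exists p : seq V, [/\ path_between x y p,
    (count (fun e => red e w) (pairmap edge x p))%:R <= rho &
    ((\sum_(e <- pairmap edge x p) X e w)%:E < u)%E].
Proof.
split=> [/ereal_inf_ltP[_ [p [pb pr] <-] pu]|[p [pb pr pu]]]; first by exists p.
by apply/ereal_inf_ltP; exists (\sum_(e <- pairmap edge x p) X e w)%:E => //; exists p.
Qed.

(** The infimum is below [u] if and only if one of countably many paths is. *)
Lemma measurable_min_cost : measurable_fun [set: T] min_cost_rv.
Proof.
apply: (measurability _ (ErealGenInftyO.measurableE R)) => // _ [_ [u ->] <-].
rewrite setTI (_ : _ @^-1` _ = \bigcup_(p : seq V) [set w | path_between x y p /\
    ((count (fun e => red e w) (pairmap edge x p))%:R <= rho /\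
     ((\sum_(e <- pairmap edge x p) X e w) < u))]); last first.
  apply/seteqP; split=> w /=; rewrite in_itv /=.
    by move=> /min_cost_rv_lt[p [pb pr pu]]; exists p.
  by move=> [p _ /= [pb [pr pu]]]; apply/min_cost_rv_lt; exists p.
apply: countable_bigcupT_measurable; first exact: countableP.
move=> p; have [pb|npb] := pselect (path_between x y p); last first.
  by rewrite (_ : [set _ | _] = set0)//; apply/seteqP; split=> // w [].
rewrite (_ : [set _ | _] = [set w | (\sum_(e <- pairmap edge x p) (red e w)%:R <= rho)]
   `&` [set w | (\sum_(e <- pairmap edge x p) X e w) < u]); last first.
  have cE w : (count (fun e => red e w) (pairmap edge x p))%:R =
      \sum_(e <- pairmap edge x p) (red e w)%:R :> R.
    rewrite -sum1_count natr_sum big_mkcond; apply: eq_bigr => e _.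
    by case: (red e w).
  by apply/seteqP; split=> w /=; rewrite cE => -[] // _ [].
apply: measurableI.
  rewrite (_ : [set _ | _] = (fun w => \sum_(e <- pairmap edge x p) (red e w)%:R : R)
      @^-1` `]-oo, rho]); last by apply/seteqP; split=> w /=; rewrite in_itv.
  rewrite -[_ @^-1` _]setTI; apply: (_ : measurable_fun setT _) => //.
  apply: measurable_sum => e.
  apply: (@measurableT_comp _ _ _ _ _ _ (fun b : bool => b%:R : R)) => //.
rewrite (_ : [set _ | _] = (fun w => \sum_(e <- pairmap edge x p) X e w)
    @^-1` `]-oo, u[); last by apply/seteqP; split=> w /=; rewrite in_itv.
rewrite -[_ @^-1` _]setTI; apply: (_ : measurable_fun setT _) => //.
by apply: measurable_sum => e.
Qed.

Lemma measurable_min_cost_near (b e : R) :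
  measurable [set w | (`|min_cost_rv w - b%:E| <= e%:E)%E].
Proof.
rewrite -[X in measurable X]setTI.
apply: emeasurable_fun_infty_c => //.
apply: measurableT_comp => //; apply: emeasurable_funB => //.
exact: measurable_min_cost.
Qed.

Lemma min_cost_near_le (w : T) (b e : R) :
  (min_cost_rv w <= (b + e)%:E)%E -> ~ (min_cost_rv w < (b - e)%:E)%E ->
  (`|min_cost_rv w - b%:E| <= e%:E)%E.
Proof.
move=> ub /negP; rewrite -leNgt => lb.
case: (min_cost_rv w) ub lb => [z| |]//=; rewrite !lee_fin => ub lb.
by rewrite ler_distl lb.
Qed.

Variables (K : nat) (a : R).
Hypothesis a_gt0 : 0 < a.

Lemma min_cost_le_reach (w : T) (C r0 : nat) : r0%:R <= rho ->
  reach edge (labels D X red K a w) x [set: V]%SET y C r0 ->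
  (min_cost_rv w <= (C%:R * a)%:E)%E.
Proof.
move=> rr [p [up lp _ Kp [Cp rp]]].
have pD e : e \in pairmap edge x p -> e \in D.
  by case/(pairmap_edgeP up) => i [j [_ _ ij ->]]; exact: edge_in.
apply: le_trans (_ : (\sum_(e <- pairmap edge x p) X e w)%:E <= _)%E.
  apply: ereal_inf_lbound; exists p => //; split=> //.
  apply: le_trans rr; rewrite ler_nat; apply: leq_trans rp.
  rewrite leq_eqVlt; apply/orP; left; apply/eqP; apply: eq_in_count => e /pD eD.
  by rewrite ffunE eD.
rewrite lee_fin; apply: le_trans (_ : (\sum_(e <- pairmap edge x p)
    (labels D X red K a w e).1.+1)%:R * a <= _); last first.
  by rewrite ler_wpM2r ?(ltW a_gt0)// ler_nat.
rewrite natr_sum mulr_suml big_seq [leRHS]big_seq; apply: ler_sum => e ep.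
have := allP Kp e ep; rewrite ffunE (pD _ ep) /= inordK; last first.
  by rewrite ltnS cost_class_le.
exact: cost_class_ub.
Qed.

Lemma min_cost_ge_cheap (w : T) (N l : R) : 0 < N ->
  (forall e, e \in D -> 0 <= X e w) ->
  (min_cost_rv w < l%:E)%E ->
  exists p, cheap_path edge (N * a) (N * l) rho x y p (labels D X red K a w).
Proof.
move=> N0 X0 /min_cost_rv_lt[p [[up lp] pr pl]]; exists p.
have pD e : e \in pairmap edge x p -> e \in D.
  by case/(pairmap_edgeP up) => i [j [_ _ ij ->]]; exact: edge_in.
apply/and4P; split=> //; first exact/eqP.
  rewrite -mulr_sumr -mulrA ler_pM2l//; rewrite lte_fin in pl.
  apply: le_trans (ltW pl); rewrite mulr_sumr big_seq [leRHS]big_seq.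
  apply: ler_sum => e ep; rewrite ffunE (pD _ ep) /= inordK; last first.
    by rewrite ltnS cost_class_le.
  by rewrite mulrC; apply: cost_class_lb => //; apply: X0; exact: pD.
rewrite (eq_in_count (a2 := fun e => red e w))// => e /pD eD.
by rewrite ffunE eD.
Qed.

Lemma negative_costs : measurable [set w | exists2 e, e \in D & X e w < 0] /\
  P [set w | exists2 e, e \in D & X e w < 0] = 0%E.
Proof.
have mN e : measurable (X e @^-1` `]-oo, 0[).
  by have mI := measurable_itv (`]-oo, 0[ : interval R);
    rewrite -[_ @^-1` _]setTI; exact: measurable_funPT.
have -> : [set w | exists2 e, e \in D & X e w < 0] =
    \bigcup_(e in [set` D]) (X e @^-1` `]-oo, 0[).
  by apply/seteqP; split=> w /= [e eD Xe]; exists e => //; move: Xe; rewrite /= in_itv.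
have mU : measurable (\bigcup_(e in [set` D]) (X e @^-1` `]-oo, 0[)).
  by apply: fin_bigcup_measurable.
split=> //; apply/eqP; rewrite -measure_le0.
apply: (@le_trans _ _ (\sum_(e \in [set` D]) P (X e @^-1` `]-oo, 0%R[))%E).
  by apply: content_sub_fsum.
rewrite fsbig1// => e eD; apply: (exponential_neg (X := X e)) => A mA.
exact: (cost_law costs eD).
Qed.

End MinCost.

Section NearProbability.
Local Open Scope classical_set_scope.
Local Open Scope ring_scope.
Variables (R : realType) (d : measure_display) (T : measurableType d).
Variables (P : probability T R) (V E : finType) (edge : V -> V -> E) (D : {set E}).
Hypothesis edge_in : forall i j, i != j -> edge i j \in D.
Variables (X : E -> {RV P >-> R}) (red : E -> {RV P >-> bool}).
Hypothesis costs : coloured_costs D X red.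

(** The two bounds may use different discretisations of the same costs. *)
Lemma min_cost_near_prob (rho b e e1 e2 N : R) (x y : V)
    (K1 K2 : nat) (a1 a2 : R) (C r0 : nat) :
    0 < a1 -> 0 < a2 -> 0 < N -> r0%:R <= rho -> C%:R * a1 <= b + e ->
    1 - e1 <= Pr (@label_mass R E D K1 a1)
      [set f | `[< reach edge f x [set: V]%SET y C r0 >] ]%SET ->
    Pr (@label_mass R E D K2 a2)
      [set f | `[< exists p, cheap_path edge (N * a2) (N * (b - e)) rho x y p f >] ]%SET
      <= e2 ->
  ((1 - (e1 + e2))%:E <=
    P [set w | (`|min_cost_rv edge X red rho x y w - b%:E| <= e%:E)%E])%E.
Proof.
move=> a10 a20 N0 rr Cb.
set G := (X in Pr _ X); set B := (X in _ -> Pr _ X <= _ -> _) => PG PB.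
have [mG eG] := labels_law costs a10 G.
have [mB eB] := labels_law costs a20 B.
have [mN eN] := negative_costs costs.
set A := [set w | (_ <= _)%E].
have mA : measurable A by exact: measurable_min_cost_near.
set G' := [set w | labels D X red K1 a1 w \in G] in mG eG.
set B' := [set w | labels D X red K2 a2 w \in B] in mB eB.
set N' := [set w | exists2 e, e \in D & X e w < 0] in mN eN.
have sub : ~` A `<=` (~` G' `|` B') `|` N'.
  move=> w nA; apply: contrapT => /not_orP[/not_orP[/contrapT Gw Bw] Nw].
  apply: nA; apply: min_cost_near_le.
    move: Gw; rewrite /G' /= inE => /asboolP Gw.
    by apply: le_trans (min_cost_le_reach edge_in a10 rr Gw) _; rewrite lee_fin.
  move=> lt; apply: Bw; rewrite /B' /= inE; apply/asboolP.
  apply: min_cost_ge_cheap => // e' e'D; rewrite leNgt; apply/negP => Xneg.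
  by apply: Nw; exists e'.
have mGB : measurable (~` G' `|` B') by apply: measurableU => //; exact: measurableC.
have PA : (P (~` A) <= (e1 + e2)%:E)%E.
  apply: le_trans (_ : P ((~` G' `|` B') `|` N') <= _)%E.
    by apply: le_measure; rewrite ?inE//; [exact: measurableC|exact: measurableU].
  apply: le_trans (measureU2 _ mGB mN) _.
  rewrite [X in (_ + X)%E]eN adde0.
  apply: le_trans (measureU2 _ (measurableC mG) mB) _.
  rewrite [X in (_ + X)%E]eB EFinD leeD// ?lee_fin//.
  rewrite [leLHS](probability_setC P mG).
  by rewrite [X in (_ - X)%E]eG -EFinB lee_fin; lra.
have := probability_setC P mA; move: PA; rewrite -[X in (_ - X)%E]fineK; last first.
  by rewrite fin_num_measure.
move=> PA PAE; rewrite PAE -EFinB lee_fin in PA.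
rewrite -[leRHS]fineK ?fin_num_measure// lee_fin; lra.
Qed.

End NearProbability.

(** * Asymptotics *)

Section Asymptotics.
Local Open Scope set_scope.
Local Open Scope ring_scope.
Variable R : realType.

Lemma ln_eventually_large (M : R) : exists n0 : nat, forall n : nat, (n0 <= n)%N ->
  M <= ln (n%:R : R) /\ M * ln (n%:R : R) <= Num.sqrt n%:R.
Proof.
set A := `|M| + 1; have A0 : 0 < A by rewrite ltr_wpDl.
have MA : M <= A by have := ler_norm M; rewrite /A; lra.
exists (Num.truncn (expR A + (4 * A) ^+ 4)).+1 => n; rewrite truncn_lt_nat; last first.
  by rewrite addr_ge0 ?expR_ge0// exprn_ge0// mulr_ge0// ltW.
move=> nlt.
have [e0 p0] : 0 < expR A /\ 0 <= (4 * A) ^+ 4.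
  by split; [exact: expR_gt0|rewrite exprn_ge0// mulr_ge0// ltW].
have n0 : 0 < n%:R :> R by lra.
have ln0 : A <= ln (n%:R : R).
  by rewrite -[leLHS]expRK ler_ln ?posrE//; lra.
split; first lra.
set y := Num.sqrt (n%:R : R); have y0 : 0 < y by rewrite sqrtr_gt0.
have yE : n%:R = y ^+ 2 by rewrite sqr_sqrtr// ltW.
set z := Num.sqrt y; have z0 : 0 < z by rewrite sqrtr_gt0.
have zE : y = z ^+ 2 by rewrite sqr_sqrtr// ltW.
(* [z] is the fourth root of [n], so [ln n = 4 * ln z] is negligible against
   [z ^+ 2]. *)
have lnz : ln (n%:R : R) <= 4 * z.
  rewrite yE zE -exprM lnXn// -mulr_natl.
  by have := ln_sublinear z0; lra.
have zA : 4 * A <= z.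
  rewrite -(@ler_pXn2r _ 4) ?nnegrE ?(ltW z0) ?mulr_ge0 ?(ltW A0)//.
  by rewrite (_ : z ^+ 4 = n%:R); [lra|rewrite yE zE -exprM].
apply: le_trans (_ : A * (4 * z) <= _).
  apply: le_trans (_ : A * ln n%:R <= _); last by rewrite ler_wpM2l// ltW.
  by rewrite ler_wpM2r//; lra.
by rewrite zE expr2 mulrA [A * 4]mulrC ler_wpM2r// ltW.
Qed.

Lemma rate_equation_gt (alpha lambda l : R) : 0 < alpha -> 0 < lambda ->
  rate_equation alpha lambda -> lambda < l ->
  1 < l / 2 + alpha * ln (l / (2 * alpha)) + alpha.
Proof.
move=> a0 l0; rewrite /rate_equation => eq ll; have l'0 := lt_trans l0 ll.
have : ln (lambda / (2 * alpha)) < ln (l / (2 * alpha)).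
  rewrite ltr_ln ?posrE ?divr_gt0 ?mulr_gt0//.
  by rewrite ltr_pM2r// invr_gt0 mulr_gt0.
by move=> ltl; have := ltl; rewrite -(ltr_pM2l a0 (ln _)) => h; lra.
Qed.

Section UpperBound.
Variables (alpha lambda eps err : R).
Hypothesis alpha_gt0 : 0 < alpha.
Hypothesis lambda_gt : 2 * alpha < lambda.
Hypothesis lambda_eq : rate_equation alpha lambda.
Hypothesis eps_gt0 : 0 < eps.
Hypothesis err_gt0 : 0 < err.

Let lambda_gt0 : 0 < lambda.
Proof. by apply: lt_trans lambda_gt; rewrite mulr_gt0. Qed.

(** A strict inequality in the rate equation at [lambda * (1 + eps / 2)] leaves room
for [delta] and for the rounding of classes, which adds [h] units to the cost of
a block and is negligible for large [k]. *)
Lemma block_choice : exists t r m0 k : nat, exists delta : R,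
  [/\ (0 < k)%N, (1 < m0)%N, (m0 * (t`! * r`!) <= t ^ (t + r))%N, 0 < delta &
   r%:R < alpha * ln (m0%:R : R) /\
   (t * k + (t + r))%N%:R * (2 * (1 + 3 * delta) / k%:R) <=
     lambda * (1 + eps / 2) * ln (m0%:R : R)].
Proof.
set l1 := lambda * (1 + eps / 2).
have ll1 : lambda < l1 by rewrite /l1 mulrDr mulr1 ltrDl mulr_gt0// divr_gt0.
have l10 : 0 < l1 by exact: lt_trans ll1.
have F1 := rate_equation_gt alpha_gt0 lambda_gt0 lambda_eq ll1.
set theta := 2 * alpha / l1.
have th0 : 0 < theta by rewrite divr_gt0// mulr_gt0.
have th1 : theta < 1.
  by rewrite ltr_pdivrMr// mul1r; exact: lt_trans ll1.
have lnth : ln theta = - ln (l1 / (2 * alpha)).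
  have q0 : 0 < l1 / (2 * alpha) by rewrite divr_gt0// mulr_gt0.
  by rewrite /theta -invf_div lnV.
have cth : 2 / l1 < 1 + theta * (1 - ln theta).
  rewrite ltr_pdivrMr// mulrDl mul1r mulrAC /theta divfK ?lt0r_neq0//.
  by rewrite lnth; lra.
have [t [r [m0 [t0 m02 rle m0le cln]]]] := block_parameters th0 th1 cth (divr_gt0 (ltr0Sn R 1) l10).
set L0 := ln (m0%:R : R) in cln *.
have tR0 : 0 < t%:R :> R by rewrite ltr0n.
have tL : 2 * t%:R < l1 * L0.
  by move: cln; rewrite mulrAC ltr_pdivrMr// mulrC [L0 * _]mulrC.
(* [rho] measures the room left: a block costs [2 * t * (1 + 3 * delta) ^+ 2]
   once [h <= 3 * delta * t * k], and this has to be at most [2 * t * rho]. *)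
set rho := l1 * L0 / (2 * t%:R).
have rho1 : 1 < rho by rewrite ltr_pdivlMr ?mulr_gt0// mul1r.
set delta := Num.min 1 (rho - 1) / 16.
have mn0 : 0 < Num.min 1 (rho - 1) by rewrite lt_min ltr01 subr_gt0.
have d0 : 0 < delta by rewrite divr_gt0.
have d1 : 16 * delta <= 1 /\ 16 * delta <= rho - 1.
  have -> : 16 * delta = Num.min 1 (rho - 1) by rewrite /delta; field.
  by rewrite !ge_min !lexx orbT.
set k := (Num.truncn ((t + r)%:R / (3 * delta * t%:R))).+1.
have kgt : (t + r)%:R / (3 * delta * t%:R) < k%:R.
  by rewrite -truncn_le_nat.
have kR0 : 0 < k%:R :> R by rewrite ltr0n.
have hk : (t + r)%:R < 3 * delta * t%:R * k%:R.
  by move: kgt; rewrite ltr_pdivrMr ?mulr_gt0// mulrC.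
exists t, r, m0, k, delta; rewrite -/L0; split=> //; split.
  apply: le_lt_trans rle _.
  have : alpha * (2 / l1 * t%:R) < alpha * L0 by rewrite ltr_pM2l.
  by rewrite /theta; lra.
apply: le_trans (_ : 2 * t%:R * rho <= _); last first.
  by rewrite /rho mulrC divfK// mulf_neq0// lt0r_neq0.
apply: le_trans (_ : 2 * t%:R * (1 + 3 * delta) ^+ 2 <= _); last first.
  rewrite ler_wpM2l ?mulr_ge0//.
  have dd : delta * delta <= delta * 1 by rewrite ler_wpM2l ?(ltW d0)//; lra.
  by rewrite expr2; lra.
rewrite mulrA ler_pdivrMr// natrD natrM.
have p : 0 <= 2 * (1 + 3 * delta) by lra.
have := ler_wpM2l p (ltW hk); lra.
Qed.

(** Every requirement of [Pr_reach_ge] and on the cost and colours of the path is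
implied by [M <= ln N] and [M * ln N <= sqrt N] for a suitable constant [M]:
errors are of order [1 / sigma] with [sigma] constant, the number of blocks is
of order [ln N] and the number of vertices used of order [ln N * sqrt N]. *)
Lemma upper_asymptotic : exists M : R, forall (V E : finType) (edge : V -> V -> E)
    (D : {set E}) (x y : V),
    edge_injective edge ->
    (forall i j, i != j -> edge i j \in D) -> x != y ->
    M <= ln (#|V|%:R : R) -> M * ln (#|V|%:R : R) <= Num.sqrt #|V|%:R ->
  exists (K : nat) (a : R) (C r0 : nat),
    [/\ 0 < a, r0%:R <= alpha * ln (#|V|%:R : R),
      C%:R * a <= (1 + eps) * (lambda * ln (#|V|%:R : R) / #|V|%:R) &
      1 - err <= Pr (@label_mass R E D K a)
        [set f | `[< reach edge f x [set: V] y C r0 >] ]].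
Proof.
have red_count u v : ((1 + u * v) * 2 + 1 = 3 + 2 * u * v)%N by lia.
have cost_count u v j : ((u + v * j) * 2 + u = 3 * u + 2 * v * j)%N by lia.
have used_count u v : ((u + v) * 2 + 2 = u * 2 + 2 + 2 * v)%N by lia.
have [t [r [m0 [k [delta [k0 m02 m0le d0 [rL WL]]]]]]] := block_choice.
set L0 := ln (m0%:R : R) in rL WL.
set h := (t + r)%N; set J := (t * k)%N; rewrite -/h -/J in WL.
set eta := 2 * (1 + 3 * delta) / k%:R in WL.
set W := (J + h)%:R * eta in WL.
have kR0 : 0 < k%:R :> R by rewrite ltr0n.
have L00 : 0 < L0 by rewrite ln_gt0// ltr1n.
have eta0 : 0 < eta by rewrite divr_gt0//; lra.
have W0 : 0 <= W by rewrite mulr_ge0// ltW.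
(* All errors in [Pr_reach_ge] are bounded by multiples of [sigma^-1]. *)
pose Cst : R := 2 + (h%:R * (2 * step_error J delta h 1) + 2) * 2.
have se0 n : 0 <= step_error J delta h n by exact: step_error_ge0.
have Cst0 : 0 < Cst.
  by have : 0 <= h%:R * (2 * step_error J delta h 1) by [rewrite mulr_ge0// mulr_ge0]; rewrite /Cst; lra.
pose sigma := (Num.truncn (Cst / err)).+1.
have sigma_gt : Cst / err < sigma%:R by rewrite -truncn_le_nat.
have s0 : (0 < sigma)%N by [].
clearbody sigma.
have sR0 : 0 < sigma%:R :> R by rewrite ltr0n.
have Cs : Cst / sigma%:R <= err.
  by rewrite ler_pdivrMr// mulrC -ler_pdivrMr// ltW.
pose xi := delta / (3 * (1 + 3 * delta)).
have d3 : 0 < 3 * (1 + 3 * delta) by lra.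
have xi0 : 0 < xi by rewrite divr_gt0.
have xi3 : 3 * (1 + 3 * delta) * xi = delta by rewrite /xi mulrC divfK ?lt0r_neq0.
have xi2 : xi <= 2^-1 by rewrite /xi ler_pdivrMr//; lra.
clearbody xi.
have xid : 1 + delta <= (1 + 3 * delta) * (1 - xi) ^+ 3.
  have x3 : 1 - 3 * xi <= (1 - xi) ^+ 3.
    have h1 : xi * xi * xi <= xi * xi by apply: ler_piMr; [rewrite mulr_ge0// ltW|lra].
    have h2 : 0 <= xi * xi by rewrite mulr_ge0// ltW.
    by rewrite !exprS expr0; lra.
  have p : 0 <= 1 + 3 * delta by lra.
  have := ler_wpM2l p x3; lra.
pose ks := (k ^ h * sigma)%N.
pose B : R := (type_bound J k h * sigma)%N%:R * m0%:R.
have B0 : 0 <= B by rewrite mulr_ge0.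
pose eps3 := lambda * eps / 12.
have e30 : 0 < eps3 by rewrite divr_gt0// mulr_gt0.
pose c1 : R := (ks * 2 + 2)%N%:R.
have g0 : 0 < alpha - r%:R / L0 by rewrite subr_gt0 ltr_pdivrMr.
(* The requirements on [N], in this order: few vertices are hit twice, few are
   used, [J < K], the start is likely, and the rounding of the number of blocks
   fits into the cost and into the colour budget. *)
pose M1 := B * eps3 / xi.
pose M2 := (c1 + (L0^-1 + 2) * h%:R * B * 2) / xi.
pose M3 := J.+1%:R * eta / eps3.
pose M4 := (32 * ks%:R + eta) / eps3.
pose M5 := 8 * W / (lambda * eps).
pose M6 := (3 + 2 * r%:R) / (alpha - r%:R / L0).
have M10 : 0 <= M1 by rewrite divr_ge0 ?mulr_ge0 ?(ltW e30)// ltW.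
have M20 : 0 <= M2.
  rewrite divr_ge0 ?(ltW xi0)// addr_ge0// !mulr_ge0// addr_ge0// invr_ge0 ltW//.
have M30 : 0 <= M3 by apply: divr_ge0 (ltW e30); rewrite mulr_ge0// ltW.
have M40 : 0 <= M4.
  by apply: divr_ge0 (ltW e30); apply: addr_ge0 (ltW eta0); rewrite mulr_ge0.
have le0 : 0 < lambda * eps by rewrite mulr_gt0.
have M50 : 0 <= M5 by apply: divr_ge0 (ltW le0); rewrite mulr_ge0.
have M60 : 0 <= M6 by apply: divr_ge0 (ltW g0); rewrite addr_ge0// mulr_ge0.
exists (1 + M1 + M2 + M3 + M4 + M5 + M6) => V E edge D x y einj ein xy.
set ell := ln _; set yy := Num.sqrt _; set N : R := #|V|%:R.
move=> Mell Myy.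
have ell1 : 1 <= ell by lra.
have ell0 : 0 <= ell by lra.
have V1 : (1 < #|V|)%N.
  by rewrite (cardD1 x) (cardD1 y) !inE eq_sym xy.
have N0 : 0 < N by rewrite ltr0n ltnW.
have NE : N = yy * yy by rewrite -expr2 sqr_sqrtr// ltW.
have yy0 : 0 <= yy by exact: sqrtr_ge0.
have le_part Mi : 0 <= Mi -> Mi <= 1 + M1 + M2 + M3 + M4 + M5 + M6 ->
    Mi * ell <= yy /\ Mi <= ell.
  move=> Mi0 MiM; split; last exact: le_trans Mell.
  by apply: le_trans Myy; rewrite ler_wpM2r.
have [y1 _] : 1 * ell <= yy /\ 1 <= ell by apply: le_part; lra.
have [p1 _] : M1 * ell <= yy /\ M1 <= ell by apply: le_part => //; lra.
have [p2 _] : M2 * ell <= yy /\ M2 <= ell by apply: le_part => //; lra.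
have [_ p3] : M3 * ell <= yy /\ M3 <= ell by apply: le_part => //; lra.
have [_ p4] : M4 * ell <= yy /\ M4 <= ell by apply: le_part => //; lra.
have [_ p5] : M5 * ell <= yy /\ M5 <= ell by apply: le_part => //; lra.
have [_ p6] : M6 * ell <= yy /\ M6 <= ell by apply: le_part => //; lra.
clear le_part Mell Myy.
(* The smallest number of blocks for which [m0 ^ m >= sqrt N]. *)
pose m := up_log (m0 ^ 2) #|V|.
have m021 : (1 < m0 ^ 2)%N by rewrite -(exp1n 2) ltn_exp2r.
have /andP[mlt mge] : ((m0 ^ 2) ^ m.-1 < #|V| <= (m0 ^ 2) ^ m)%N.
  exact: up_log_bounds.
have m_gt0 : (0 < m)%N.
  by rewrite lt0n; apply/eqP => m0'; move: mge; rewrite m0' expn0 leqNgt V1.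
have mE : m = m.-1.+1 by rewrite prednK.
have mR0 : 0 < m0%:R :> R by rewrite ltr0n ltnW.
have m2L : 2 * m%:R * L0 <= ell + 2 * L0.
  have : ln (((m0 ^ 2) ^ m.-1)%N%:R : R) <= ell.
    have pw0 : 0 < ((m0 ^ 2) ^ m.-1)%N%:R :> R by rewrite ltr0n !expn_gt0 ltnW.
    by rewrite /ell ler_ln ?posrE// /N ler_nat ltnW.
  rewrite !natrX !lnXn ?exprn_gt0// -/L0 -[X in X <= _ -> _]mulr_natl => le.
  by rewrite mE -natr1; move: le; set mp := m.-1%:R; lra.
have m2 : 2 * m%:R <= ell / L0 + 2.
  rewrite (_ : ell / L0 + 2 = (ell + 2 * L0) / L0); first by rewrite ler_pdivlMr.
  by field; rewrite lt0r_neq0.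
have mpow : m0%:R ^+ m <= m0%:R * yy.
  rewrite mE exprS ler_wpM2l//.
  rewrite -(@ler_pXn2r _ 2) ?nnegrE ?exprn_ge0// sqr_sqrtr ?(ltW N0)//.
  by rewrite -!natrX /N ler_nat -expnM mulnC expnM ltnW.
(* Each of the three cheap edges may cost [lambda * eps * ln N / (12 * N)]. *)
pose K := Num.truncn (eps3 * ell / eta).
have Kle : K%:R * eta <= eps3 * ell.
  rewrite -ler_pdivlMr// -truncn_ge_nat// divr_ge0 ?(ltW eta0)//.
  by rewrite mulr_ge0 ?(ltW e30).
have Kge : eps3 * ell - eta < K%:R * eta.
  have : eps3 * ell / eta < K.+1%:R by rewrite -truncn_le_nat.
  by rewrite ltr_pdivrMr// -natr1; lra.
have JK : (J < K)%N.
  rewrite truncn_gt_nat ler_pdivlMr//.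
  by move: p3; rewrite /M3 ler_pdivrMr// [ell * _]mulrC.
clearbody K m.
pose Z := (type_bound J k h * (sigma * m0 ^ m))%N.
have ZB : Z%:R <= B * yy.
  rewrite /Z mulnA natrM natrX /B -mulrA ler_wpM2l//.
have ZK : Z%:R * (K%:R * eta) <= xi * N.
  apply: le_trans (_ : (B * yy) * (eps3 * ell) <= _).
    by apply: ler_pM => //; rewrite mulr_ge0// ltW.
  have : B * eps3 * ell <= xi * yy.
    by move: p1; rewrite /M1 mulrAC ler_pdivrMr// [yy * _]mulrC.
  by move=> q; have := ler_wpM2r yy0 q; rewrite NE; lra.
have FN : ((k ^ h * sigma + m * (h * Z)) * 2 + 2)%N%:R <= xi * N.
  have q : (c1 + (L0^-1 + 2) * h%:R * B * 2) * ell <= xi * yy.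
    by move: p2; rewrite /M2 mulrAC ler_pdivrMr// [yy * _]mulrC.
  have q2 := ler_wpM2r yy0 q.
  have c1y : c1 <= c1 * (ell * yy).
    apply: ler_peMr => //; apply: (le_trans ell1); apply: ler_peMr => //.
    by apply: (le_trans ell1); rewrite -[ell]mul1r.
  have mell : 2 * m%:R <= (L0^-1 + 2) * ell by lra.
  have mhZ : 2 * (m%:R * (h%:R * Z%:R)) <= (L0^-1 + 2) * ell * (h%:R * (B * yy)).
    rewrite mulrA; apply: ler_pM => //; rewrite ?mulr_ge0//.
    by rewrite ler_wpM2l.
  have hBy : 0 <= (L0^-1 + 2) * ell * (h%:R * (B * yy)).
    by rewrite !mulr_ge0// addr_ge0// invr_ge0 ltW.
  have -> : ((k ^ h * sigma + m * (h * Z)) * 2 + 2)%N%:R =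
      c1 + 2 * (m%:R * (h%:R * Z%:R)) :> R.
    by rewrite used_count natrD; congr (_ + _); rewrite !natrM.
  rewrite NE; apply: (le_trans (lerD c1y mhZ)); rewrite [xi * _]mulrA.
  apply: (le_trans _ q2).
  rewrite (_ : (c1 + _) * ell * yy = c1 * (ell * yy) +
    (L0^-1 + 2) * ell * (h%:R * (B * yy)) +
    (L0^-1 + 2) * ell * (h%:R * (B * yy))); last by ring.
  by rewrite lerDl.
have Kbig : 32 * (k ^ h * sigma)%:R <= K%:R * eta.
  by move: p4; rewrite /M4 ler_pdivrMr// -/ks; lra.
have mN : (#|V| <= (m0 ^ m) ^ 2)%N by rewrite -expnM mulnC expnM.
exists K, (eta / N), ((K + m * (J + h)) * 2 + K)%N, ((1 + m * r) * 2 + 1)%N.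
split.
- by rewrite divr_gt0.
- rewrite red_count natrD !natrM.
  have q : 3 + 2 * r%:R <= ell * (alpha - r%:R / L0).
    by move: p6; rewrite /M6 ler_pdivrMr.
  have rR0 : 0 <= r%:R :> R by [].
  have := ler_wpM2r rR0 m2; lra.
- rewrite mulrA [leRHS]mulrA ler_wpM2r ?invr_ge0 ?(ltW N0)//.
  rewrite cost_count natrD !natrM mulrDl -[2 * m%:R * _ * _]mulrA -/W.
  have q : 8 * W <= ell * (lambda * eps).
    by move: p5; rewrite /M5 ler_pdivrMr// mulr_gt0.
  have q2 : ell / L0 * W <= ell * (lambda * (1 + eps / 2)).
    rewrite mulrAC ler_pdivrMr// -mulrA ler_wpM2l//.
  have := ler_wpM2r W0 m2; move: Kle; rewrite /eps3; lra.
apply: le_trans _ (Pr_reach_ge einj ein (t := t) (r := r) (m := m) xy k0 s0 m02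
  m0le d0 erefl xi0 xi2 xid JK ZK FN Kbig mN).
rewrite lerD2l lerN2; apply: le_trans Cs; rewrite /Cst -/h -/J.
have -> : step_error J delta h sigma = step_error J delta h 1 / sigma%:R.
  rewrite /step_error; field.
  by rewrite !lt0r_neq0// exprn_gt0.
have ksle : 2 / (k ^ h * sigma)%:R <= 2 / sigma%:R :> R.
  rewrite ler_wpM2l// lef_pV2 ?posrE ?ltr0n ?muln_gt0 ?expn_gt0 ?k0 ?s0//.
  by rewrite ler_nat leq_pmull// expn_gt0 k0.
move: ksle; rewrite mulrDl mulrDl mulrDl mulrAC; lra.
Qed.

End UpperBound.
End Asymptotics.

Section LowerBound.
Local Open Scope set_scope.
Local Open Scope ring_scope.

(** By the choice of [sigma], [c * lambda + sigma * alpha = 1] is the rate equation.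
As [theta] exceeds [c] by a factor smaller than [1 / (1 - eps)], the exponent of
the union bound is [(1 - g) * ln N] with [g > 0], against the factor [1 / N]. *)
Lemma lower_asymptotic (R : realType) (alpha lambda eps err : R) :
    0 < alpha -> 2 * alpha < lambda -> rate_equation alpha lambda ->
    0 < eps -> eps < 1 -> 0 < err ->
  exists M : R, forall (V E : finType) (edge : V -> V -> E)
    (D : {set E}) (x y : V),
    edge_injective edge ->
    (forall i j, i != j -> edge i j \in D) -> x != y ->
    M <= ln (#|V|%:R : R) ->
  exists (K : nat) (a : R), 0 < a /\
    let N : R := #|V|%:R in
    let b := lambda * ln N / N in
    Pr (@label_mass R E D K a)
      [set f | `[< exists p, cheap_path edge (N * a) (N * (b - eps * b))
                   (alpha * ln N) x y p f >] ] <= err.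
Proof.
move=> alpha_gt0 lambda_gt lambda_eq eps_gt0 eps_lt1 err_gt0.
have lambda_gt0 : 0 < lambda by apply: lt_trans lambda_gt; rewrite mulr_gt0.
set sigma := ln (lambda / (2 * alpha)).
have sigma0 : 0 < sigma by rewrite ln_gt0// ltr_pdivlMr ?mulr_gt0// mul1r.
set c := (1 + expR (- sigma)) / 2.
have cE : c * lambda + sigma * alpha = 1.
  rewrite /c expRN lnK ?posrE ?divr_gt0 ?mulr_gt0// invf_div.
  move: lambda_eq; rewrite /rate_equation -/sigma => eq.
  have -> : (1 + 2 * alpha / lambda) / 2 * lambda = lambda / 2 + alpha.
    by field; rewrite lt0r_neq0.
  by lra.
have c0 : 0 < c by rewrite divr_gt0// addr_gt0// expR_gt0.
have e2 : 0 < 1 - eps / 2 by lra.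
set theta := c / (1 - eps / 2).
have theta0 : 0 < theta by rewrite divr_gt0.
have thE : theta * (1 - eps / 2) = c by rewrite divfK// lt0r_neq0.
(* Classes so narrow that the discretised tilt still has mass below 1. *)
set eta := eps / (4 * theta).
have eta0 : 0 < eta by rewrite divr_gt0// mulr_gt0.
have etE : theta * eta = eps / 4 by rewrite /eta; field; rewrite lt0r_neq0.
set tm := tilted_mass eta theta sigma.
have q0 : 0 < 1 - expR (- (theta * eta)).
  by rewrite subr_gt0 -expR0 ltr_expR oppr_lt0 mulr_gt0.
have tm1 : tm < 1.
  rewrite /tm /tilted_mass -/c ltr_pdivrMr// mul1r.
  apply: lt_le_trans (one_sub_expR_ge _); last by rewrite mulr_ge0// ltW.
  rewrite etE -thE mulrCA mulrA etE.
  by rewrite ltr_pM2l ?divr_gt0//; lra.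
have tm0 : 0 < (1 - tm)^-1 by rewrite invr_gt0 subr_gt0.
set g := c * lambda - theta * (1 - eps) * lambda.
have g0 : 0 < g.
  rewrite /g -thE -mulrBl mulr_gt0// -mulrBr mulr_gt0//; lra.
exists ((1 - tm)^-1 / (err * g) + 1) => V E edge D x y einj ein xy.
set N : R := #|V|%:R; set ell := ln N => Mell.
have V0 : (0 < #|V|)%N by apply/card_gt0P; exists x.
have N0 : 0 < N by rewrite ltr0n.
have d0 : 0 < (1 - tm)^-1 / (err * g) by rewrite divr_gt0// mulr_gt0.
have ell0 : 0 < ell by lra.
set Lam := (1 - eps) * lambda * ell.
have Lam0 : 0 <= Lam by rewrite !mulr_ge0// ?ltW//; lra.
set K := (Num.truncn (Lam / eta)).+1.
have LK : Lam < eta * K%:R.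
  by rewrite mulrC -ltr_pdivrMr// -truncn_le_nat.
exists K, (eta / N); split; first by rewrite divr_gt0.
move=> /=; rewrite -/N -/ell.
have -> : N * (eta / N) = eta by rewrite mulrC divfK// lt0r_neq0.
have -> : N * (lambda * ell / N - eps * (lambda * ell / N)) = Lam.
  by rewrite /Lam; field; rewrite lt0r_neq0.
apply: le_trans (Pr_cheap_paths_le einj ein eta0 theta0 (ltW sigma0) V0
  (alpha * ell) xy LK tm1) _.
rewrite -/tm -/N.
have -> : theta * Lam + sigma * (alpha * ell) = ell + - (g * ell).
  have cell : (c * lambda + sigma * alpha) * ell = ell by rewrite cE mul1r.
  by rewrite -[X in X + - _]cell /g /Lam; ring.
rewrite expRD lnK ?posrE//.
rewrite (_ : N * _ * _ / N = expR (- (g * ell)) * (1 - tm)^-1); last first.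
  by field; rewrite !lt0r_neq0// -invr_gt0.
rewrite expRN -ler_pdivlMr// invrK -(@ler_pM2r _ (expR (g * ell))) ?expR_gt0//.
rewrite mulVf ?lt0r_neq0 ?expR_gt0//.
have h1 : 1 + g * ell <= expR (g * ell) by exact: expR_ge1Dx.
have e1 : 0 < err * (1 - tm) by rewrite mulr_gt0// -invr_gt0.
apply: le_trans (_ : err * (1 - tm) * (1 + g * ell) <= _); last by rewrite ler_wpM2l// ltW.
have h2 : (1 - tm)^-1 / (err * g) <= ell by lra.
have h3 : 1 <= err * (1 - tm) * (g * ell).
  move: h2; rewrite ler_pdivrMr ?mulr_gt0// => h2.
  have h4 : 0 < 1 - tm by rewrite -invr_gt0.
  have := ler_wpM2l (ltW h4) h2; rewrite mulfV ?lt0r_neq0//; lra.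
lra.
Qed.

End LowerBound.

Lemma undirected_edge_inj (V : finType) : edge_injective (@undirected_edge V).
Proof.
move=> i j i' j'; rewrite /undirected_edge => e.
have /set2P[ii|ij'] : i \in [set i'; j']%SET by rewrite -e set21.
  have /set2P[ji|jj] : j \in [set i'; j']%SET by rewrite -e set22.
    have /set2P : j' \in [set i; j]%SET by rewrite e set22.
    by rewrite ii ji => -[->|->]; left.
  by left.
have /set2P[ji|jj] : j \in [set i'; j']%SET by rewrite -e set22.
  by right.
have /set2P : i' \in [set i; j]%SET by rewrite e set21.
by rewrite ij' jj => -[->|->]; right.
Qed.

Section WithHighProbability.
Local Open Scope classical_set_scope.
Local Open Scope ring_scope.
Variables (R : realType) (alpha lambda : R).
Hypothesis alpha_gt0 : 0 < alpha.
Hypothesis lambda_gt : 2 * alpha < lambda.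
Hypothesis lambda_eq : rate_equation alpha lambda.

Lemma min_cost_whp (d : nat -> measure_display) (T : forall n, measurableType (d n))
    (P : forall n, probability (T n) R)
    (E : nat -> finType) (edge : forall n, 'I_n.+2 -> 'I_n.+2 -> E n)
    (D : forall n, {set E n})
    (X : forall n, E n -> {RV (P n) >-> R}) (red : forall n, E n -> {RV (P n) >-> bool}) :
    (forall n, edge_injective (edge n)) ->
    (forall n i j, i != j -> edge n i j \in D n) ->
    (forall n, coloured_costs (D n) (X n) (red n)) ->
  whp_equivalent P
    (fun n w => min_cost (edge n) (fun e => X n e w) (fun e => red n e w)
       (alpha * ln n.+2%:R) (vertex1 n) (vertex2 n))
    (fun n => lambda * ln n.+2%:R / n.+2%:R).
Proof.
move=> einj ein costs eps eps0.
have lambda_gt0 : 0 < lambda by apply: lt_trans lambda_gt; rewrite mulr_gt0.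
pose b n : R := lambda * ln n.+2%:R / n.+2%:R.
have b0 n : 0 <= b n by rewrite divr_ge0// mulr_ge0 ?(ltW lambda_gt0)// ln_ge0// ler1n.
(* The lower bound needs [eps < 1], and the event shrinks with [eps]. *)
pose e := Num.min eps 2^-1.
have e0 : 0 < e by rewrite lt_min eps0 invr_gt0 ltr0n.
have e1 : e < 1 by rewrite gt_min invf_lt1// ltr1n orbT.
pose A (c : R) n : set (T n) := [set w | (`|min_cost_rv (edge n) (X n) (red n)
  (alpha * ln n.+2%:R) (vertex1 n) (vertex2 n) w - (b n)%:E| <= (c * b n)%:E)%E].
have mA c n : measurable (A c n) by exact: measurable_min_cost_near.
have fA n : P n (A eps n) \is a fin_num by exact: fin_num_measure.
suff H : forall del : R, 0 < del -> exists n0 : nat, forall n, (n0 <= n)%N ->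
    ((1 - del)%:E <= P n (A e n))%E.
  rewrite /whp -/(A eps _).
  have -> : (fun n => P n (A eps n)) = (fun n => (fine (P n (A eps n)))%:E).
    by apply/funext => n; rewrite fineK.
  apply: cvg_EFin; first exact: nearW.
  apply/cvgrPdist_le => del del0; have [n0 Hn0] := H _ del0.
  exists n0 => // n /= n0n; have := Hn0 n n0n => PA.
  have sA : (P n (A e n) <= P n (A eps n))%E.
    apply: le_measure; rewrite ?inE//; move=> w /= le; apply: le_trans le _.
    by rewrite lee_fin ler_wpM2r// ge_min lexx.
  have := le_trans PA sA; rewrite -[X in (_ <= X)%E]fineK// lee_fin => ge.
  have : (P n (A eps n) <= 1)%E by exact: probability_le1.
  rewrite -[X in (X <= _)%E]fineK// lee_fin => le.
  rewrite ger0_norm; lra.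
move=> del del0; have del20 : 0 < del / 2 by rewrite divr_gt0.
have [M1 HM1] := upper_asymptotic alpha_gt0 lambda_gt lambda_eq e0 del20.
have [M2 HM2] := lower_asymptotic alpha_gt0 lambda_gt lambda_eq e0 e1 del20.
have [n1 Hn1] := ln_eventually_large M1; have [n2 Hn2] := ln_eventually_large M2.
exists (maxn n1 n2) => n; rewrite geq_max => /andP[n1n n2n].
have [l1 l2] := Hn1 n.+2 (leq_trans n1n (leqW (leqnSn n))).
have [l3 _] := Hn2 n.+2 (leq_trans n2n (leqW (leqnSn n))).
have xy : vertex1 n != vertex2 n by rewrite -val_eqE /= inordK.
have cV : #|'I_n.+2| = n.+2 by exact: card_ord.
have := HM1 _ _ (edge n) (D n) (vertex1 n) (vertex2 n) (einj n) (ein n) xy.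
rewrite cV => /(_ l1 l2)[K1 [a1 [C [r0 [a10 rr Cb PG]]]]].
have := HM2 _ _ (edge n) (D n) (vertex1 n) (vertex2 n) (einj n) (ein n) xy.
rewrite cV => /(_ l3)[K2 [a2 [a20 PB]]].
rewrite (_ : del = del / 2 + del / 2); last by lra.
have N0 : 0 < n.+2%:R :> R by [].
cbv zeta in PB.
have Cb' : C%:R * a1 <= b n + e * b n by rewrite -[b n in X in X + _]mul1r -mulrDl.
exact: (min_cost_near_prob (ein n) (costs n) a10 a20 N0 rr Cb' PG PB).
Qed.

End WithHighProbability.

Local Open Scope classical_set_scope.
Local Open Scope ring_scope.

Theorem theorem2 (R : realType) (alpha : R) (alpha_gt0 : 0 < alpha)
    (alpha_lt : alpha < 2^-1) :
  exists lambda : R,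
    unique (fun l : R => 0 < l /\ rate_equation alpha l) lambda /\
    forall (d : nat -> measure_display) (T : forall n, measurableType (d n))
        (P : forall n, probability (T n) R),
      (forall (X : forall n, {set 'I_n.+2} -> {RV (P n) >-> R})
          (red : forall n, {set 'I_n.+2} -> {RV (P n) >-> bool}),
        (forall n, coloured_costs (complete_graph 'I_n.+2) (X n) (red n)) ->
        whp_equivalent P
          (fun n w => min_cost (@undirected_edge 'I_n.+2)
             (fun e => X n e w) (fun e => red n e w)
             (alpha * ln n.+2%:R) (vertex1 n) (vertex2 n))
          (fun n => lambda * ln n.+2%:R / n.+2%:R)) /\
      (forall (X : forall n, 'I_n.+2 * 'I_n.+2 -> {RV (P n) >-> R})
          (red : forall n, 'I_n.+2 * 'I_n.+2 -> {RV (P n) >-> bool}),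
        (forall n, coloured_costs (complete_digraph 'I_n.+2) (X n) (red n)) ->
        whp_equivalent P
          (fun n w => min_cost (@directed_edge 'I_n.+2)
             (fun e => X n e w) (fun e => red n e w)
             (alpha * ln n.+2%:R) (vertex1 n) (vertex2 n))
          (fun n => lambda * ln n.+2%:R / n.+2%:R)).
Proof.
have [lambda [lambda_gt lambda_eq lambda_uniq]] := rate_lambda alpha_gt0 alpha_lt.
have lambda_gt0 : 0 < lambda by apply: lt_trans lambda_gt; rewrite mulr_gt0.
exists lambda; split.
  by split=> // l [l0 leq]; rewrite (lambda_uniq _ l0 leq).
move=> d T P; split=> X red costs.
  apply: (min_cost_whp alpha_gt0 lambda_gt lambda_eq
    (edge := fun n => @undirected_edge 'I_n.+2) _ _ costs) => n.
    exact: undirected_edge_inj.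
  by move=> i j ij; rewrite inE /undirected_edge cards2 ij.
apply: (min_cost_whp alpha_gt0 lambda_gt lambda_eq
  (edge := fun n => @directed_edge 'I_n.+2) _ _ costs) => n i j.
  by move=> i' j' [-> ->]; left.
by move=> ij; rewrite inE.
Qed.
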